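(* Let $\alpha\in(0,n)$ and let $A$ be a finite-valued Young function such that $\int_0\left(\frac t{A(t)}\right)^{\frac\alpha{n-\alpha}}dt<\infty$. Assume that either $A\in\nabla_2$ globally, or $A\in\nabla_2$ near $0$ and $$\int^\infty\left(\frac t{A(t)}\right)^{\frac\alpha{n-\alpha}}dt<\infty.$$ Then the Riesz potential $I_\alpha$ is bounded between Orlicz spaces as follows: $$I_\alpha:L^A(\mathbb R^n)\to L^{A_{\frac n\alpha}}(\mathbb R^n),$$ where $A_{\frac n\alpha}$ is the Sobolev conjugate of $A$ of order $\alpha$.
   Context: $n\ge2$. The Riesz potential is $I_\alpha f(x)=\frac{\Gamma(\frac{n-\alpha}2)}{2^\alpha\pi^{n/2}\Gamma(\alpha/2)}\int_{\mathbb R^n}\frac{f(y)}{|x-y|^{n-\alpha}}\,dy$ for a.e. $x\in\mathbb R^n$. A Young function is a convex, non-trivial, left-continuous function $A:[0,\infty)\to[0,\infty]$ with $A(0)=0$. $A\in\nabla_2$ globally if there is a constant $k>2$ with $A(2t)\ge kA(t)$ for all $t\ge0$; $A\in\nabla_2$ near $0$ if this holds for $t\in[0,t_0)$ for some $t_0>0$. $L^A(\mathbb R^n)$ is the set of measurable $u$ for which $\|u\|_{L^A(\mathbb R^n)}=\inf\{\lambda>0:\int_{\mathbb R^n}A(|u|/\lambda)\,dx\le1\}$ is finite. Sobolev conjugate: with $H_{A,\frac n\alpha}(t)=\left(\int_0^t\left(\frac\tau{A(\tau)}\right)^{\frac\alpha{n-\alpha}}d\tau\right)^{\frac{n-\alpha}n}$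 for $t\ge0$, $A_{\frac n\alpha}(t)=A(H_{A,\frac n\alpha}^{-1}(t))$, where $H_{A,\frac n\alpha}^{-1}(t)=\infty$ (and $A_{\frac n\alpha}(t)=\infty$) if $t$ exceeds the supremum of $H_{A,\frac n\alpha}$. *)

(* Defs.v *)
From HB Require Import structures.
From mathcomp Require Import all_boot all_order all_algebra.
From mathcomp Require Import all_classical all_reals all_analysis.

Set Implicit Arguments.
Unset Strict Implicit.
Unset Printing Implicit Defensive.
Import Order.TTheory GRing.Theory Num.Theory.
Import numFieldNormedType.Exports.

Local Open Scope classical_set_scope.
Local Open Scope ring_scope.
Local Open Scope ereal_scope.

Section lebesgue_measure_on_tuples.
Context {R : realType}.

Definition tcons (n : nat) (p : measurableTypeR R * n.-tuple (measurableTypeR R))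
  : n.+1.-tuple (measurableTypeR R) := [tuple of p.1 :: p.2].

Lemma measurable_tcons (n : nat) : measurable_fun [set: _] (@tcons n).
Proof. exact: measurable_cons. Qed.

Definition tuncons (n : nat) (t : n.+1.-tuple (measurableTypeR R)) :
    measurableTypeR R * n.-tuple (measurableTypeR R) :=
  (thead t, [tuple of behead t]).

Lemma measurable_tuncons (n : nat) : measurable_fun [set: _] (@tuncons n).
Proof.
by apply/measurable_fun_pair; [exact: measurable_tnth|exact: measurable_behead].
Qed.

Lemma tconsK (n : nat) : cancel (@tcons n) (@tuncons n).
Proof.
by case=> x t; congr pair; exact: val_inj.
Qed.

Section pushforward_tcons.
Variables (n : nat)
  (mu : {sigma_finite_measure set (n.-tuple (measurableTypeR R)) -> \bar R}).

(* n.+1-dimensional Lebesgue measure: the product of the Lebesgue measure on R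
   with the n-dimensional one, transported along (x, t) |-> x :: t *)
Definition tuple_product : set (n.+1.-tuple (measurableTypeR R)) -> \bar R :=
  pushforward (@lebesgue_measure R \x mu) (@tcons n).

Let tuple_product0 : tuple_product set0 = 0.
Proof. by rewrite /tuple_product /pushforward preimage_set0 measure0. Qed.

Let tuple_product_ge0 (A : set (n.+1.-tuple (measurableTypeR R))) :
  0 <= tuple_product A.
Proof. exact: (measure_ge0 (@lebesgue_measure R \x mu)). Qed.

Let tuple_product_sigma_additive : semi_sigma_additive tuple_product.
Proof.
move=> F mF tF mUF; rewrite /tuple_product /pushforward preimage_bigcup.
apply: measure_semi_sigma_additive.
- by move=> k; rewrite -[X in measurable X]setTI; exact: measurable_tcons.
- apply/trivIsetP => /= i j _ _ ij; rewrite -preimage_setI.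
  by move/trivIsetP : tF => /(_ _ _ _ _ ij) ->//; rewrite preimage_set0.
- rewrite -preimage_bigcup -[X in measurable X]setTI.
  exact: measurable_tcons.
Qed.

HB.instance Definition _ := isMeasure.Build _ _ _ tuple_product
  tuple_product0 tuple_product_ge0 tuple_product_sigma_additive.

Let tuple_product_sigma_finite : sigma_finite setT tuple_product.
Proof.
have /sigma_finiteP[F [TF ndF Foo]] := sigma_finiteT (@lebesgue_measure R).
have /sigma_finiteP[G [TG ndG Goo]] := sigma_finiteT mu.
exists (fun k => @tuncons n @^-1` (F k `*` G k)).
  apply/esym; rewrite -subTset => t _.
  have [i _ Fi] : (\bigcup_i F i) (tuncons t).1 by rewrite -TF.
  have [j _ Gj] : (\bigcup_j G j) (tuncons t).2 by rewrite -TG.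
  exists (maxn i j) => //; split => /=.
    by move: Fi; exact/subsetPset/ndF/leq_maxl.
  by move: Gj; exact/subsetPset/ndG/leq_maxr.
move=> k; have [mF Fk] := Foo k; have [mG Gk] := Goo k; split.
  rewrite -[X in measurable X]setTI.
  by apply: measurable_tuncons => //; exact: measurableX.
rewrite /tuple_product /pushforward -comp_preimage.
rewrite (_ : @tuncons n \o @tcons n = id); last exact/funext/tconsK.
by rewrite preimage_id product_measure1E// lte_mul_pinfty// ge0_fin_numE.
Qed.

HB.instance Definition _ := Measure_isSigmaFinite.Build _ _ _ tuple_product
  tuple_product_sigma_finite.

End pushforward_tcons.

Fixpoint borel_lebesgue (n : nat) :
    {sigma_finite_measure set (n.-tuple (measurableTypeR R)) -> \bar R} :=
  match n with
  | 0 => [the {sigma_finite_measure set (0.-tuple (measurableTypeR R)) -> \bar R}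
          of dirac [tuple]]
  | n'.+1 => [the {sigma_finite_measure set _ -> \bar R}
              of tuple_product (borel_lebesgue n')]
  end.

End lebesgue_measure_on_tuples.

(* R^n with the sigma-algebra of Lebesgue (not only Borel) measurable sets:
   the Caratheodory sets of the outer measure of n-dimensional Lebesgue
   measure, i.e. the completion of the Borel sigma-algebra. *)
Definition Rn (R : realType) (n : nat) :=
  caratheodory_type ((@borel_lebesgue R n)^*)%mu.

Definition lebesgueRn (R : realType) (n : nat) :
    {measure set (Rn R n) -> \bar R} :=
  @completed_measure_extension _ _ R (@borel_lebesgue R n).

Section riesz_orlicz.
Context {R : realType}.

Definition edist (n : nat) (x y : n.-tuple R) : R :=
  Num.sqrt (\sum_(i < n) (tnth x i - tnth y i) ^+ 2)%R.

(* Euler's Gamma function, for s > 0 *)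
Definition Gamma (s : R) : R :=
  (\int[@lebesgue_measure R]_(t in `]0%R, +oo[) (t `^ (s - 1) * expR (- t)))%R.

(* At the null set y = x the kernel takes the junk value 0. *)
Definition riesz_integrand (n : nat) (alpha : R) (f : Rn R n -> R) (x y : Rn R n)
  : R := (f y / edist x y `^ (n%:R - alpha))%R.

Definition riesz_potential (n : nat) (alpha : R) (f : Rn R n -> R) (x : Rn R n)
  : R :=
  (Gamma ((n%:R - alpha) / 2) /
     (2 `^ alpha * pi `^ (n%:R / 2) * Gamma (alpha / 2)) *
   \int[lebesgueRn R n]_y riesz_integrand alpha f x y)%R.

(* Functions [0, oo) -> [0, oo] are represented by maps R -> \bar R of which
   only the values on [0, oo) are ever used. *)
Definition young (A : R -> \bar R) : Prop :=
  [/\ A 0%R = 0,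
      (forall t, (0 <= t)%R -> 0 <= A t),
      (forall x y t, (0 <= x)%R -> (0 <= y)%R -> (0 <= t <= 1)%R ->
         A (t * x + (1 - t) * y)%R <= t%:E * A x + (1 - t)%:E * A y),
      (forall t, (0 < t)%R -> A s @[s --> t^'-] --> A t) &
      (* non-trivial: neither 0 nor +oo throughout (0, oo) *)
      (exists2 t, (0 < t)%R & A t != 0) /\
      (exists2 t, (0 < t)%R & A t != +oo)].

Definition finite_valued (A : R -> \bar R) : Prop :=
  forall t, (0 <= t)%R -> A t \is a fin_num.

Definition nabla2 (A : R -> \bar R) : Prop :=
  exists2 k : R, (2 < k)%R &
    forall t, (0 <= t)%R -> k%:E * A t <= A (2 * t)%R.

Definition nabla2_near0 (A : R -> \bar R) : Prop :=
  exists2 k : R, (2 < k)%R &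
    exists2 t0 : R, (0 < t0)%R &
      forall t, (0 <= t < t0)%R -> k%:E * A t <= A (2 * t)%R.

(* The quotient is taken in \bar R, so that it is +oo where A vanishes and
   0 where A is infinite. *)
Definition sobolev_integrand (n : nat) (alpha : R) (A : R -> \bar R) (t : R)
  : \bar R := (t%:E / A t) `^ (alpha / (n%:R - alpha)).

Definition sobolev_conv0 (n : nat) (alpha : R) (A : R -> \bar R) : Prop :=
  exists2 a : R, (0 < a)%R &
    \int[@lebesgue_measure R]_(t in `]0%R, a[) sobolev_integrand n alpha A t
      < +oo.

Definition sobolev_convy (n : nat) (alpha : R) (A : R -> \bar R) : Prop :=
  exists2 a : R, (0 < a)%R &
    \int[@lebesgue_measure R]_(t in `]a, +oo[) sobolev_integrand n alpha A t
      < +oo.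

Definition sobolev_H (n : nat) (alpha : R) (A : R -> \bar R) (t : R) : \bar R :=
  (\int[@lebesgue_measure R]_(s in `]0%R, t[) sobolev_integrand n alpha A s)
    `^ ((n%:R - alpha) / n%:R).

(* Inverse of H, with value +oo = inf set0 outside the range of H. *)
Definition sobolev_Hinv (n : nat) (alpha : R) (A : R -> \bar R) (t : R)
  : \bar R :=
  ereal_inf [set s%:E | s in [set s : R |
               (0 <= s)%R /\ sobolev_H n alpha A s = t%:E]].

Definition sobolev_conjugate (n : nat) (alpha : R) (A : R -> \bar R) (t : R)
  : \bar R :=
  match sobolev_Hinv n alpha A t with
  | s%:E => A s
  | _ => +oo
  end.

Definition luxemburg_norm (n : nat) (A : R -> \bar R) (u : Rn R n -> R)
  : \bar R :=
  ereal_inf [set l%:E | l in [set l : R |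
               (0 < l)%R /\ \int[lebesgueRn R n]_x A (`|u x| / l)%R <= 1]].

Definition orlicz (n : nat) (A : R -> \bar R) : set (Rn R n -> R) :=
  [set u | measurable_fun setT u /\ luxemburg_norm A u < +oo].

End riesz_orlicz.

(* Main.v *)
From HB Require Import structures.
Require Import Defs.
From mathcomp Require Import all_boot all_order all_algebra.
From mathcomp Require Import all_classical all_reals all_analysis.
From mathcomp Require Import measurable_realfun ring lra.

Import Order.TTheory GRing.Theory Num.Theory.
Import numFieldNormedType.Exports.
Local Open Scope classical_set_scope.
Local Open Scope ring_scope.
Local Open Scope ereal_scope.

Set Implicit Arguments.
Unset Strict Implicit.
Unset Printing Implicit Defensive.

(** Put phi(t) = A(t)/t, which is nondecreasing because A is convex and
    vanishes at 0, let rho = alpha/(n - alpha), and let H be the function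
    whose inverse enters the Sobolev conjugate, so that
    H(t)^(1 + rho) is the integral of phi^(-rho) over (0, t).  For f >= 0,
    let If be the integral of f against the kernel k(x, y) =
    |x - y|^(alpha - n).  The proof is a real-interpolation argument in which
    the truncation level t of f is matched with the level H(t) of If.

    The kernel enters through one bound: the integral of k over the set where
    k > tau is at most c tau^(-rho), in each variable (riesz_kernel_cutoff).
    Let f >= 0 satisfy int A(f) <= 1.

    If f <= t, then If <= (1 + c) H(t) everywhere (potential_bounded).
    Indeed a product a b with a <= t is at most N A(a) plus the integral
    over s in (0, t) of b restricted to b > N phi(s); taking a = f(y),
    b = k(x, y), N = H(t) and integrating in y, the kernel bound turns the
    second term into c N^(-rho) times the integral of phi^(-rho), that is
    c N.

    For general f the part of f above t has integral at most 1/phi(t), and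
    cutting the kernel at the height H(t) phi(t)/2 gives
    |{If >= (2 + c) H(t)}| <= (C/t) int_{f > t} f (potential_weak_type).

    The Sobolev conjugate is bounded by A*(w) <= int phi(t) 1{H(t) <= 2 w} dt
    (sobolev_conjugate_le), because H(2 s) <= 2 H(s).  Integrating this in x
    for w proportional to If and inserting the weak-type bound leaves the
    integral of f(y) times the integral of phi(t)/t over t < f(y).  When A
    is nabla_2, the inner integral is at most C phi(f(y)) (slope_dini), so
    int A*(If/lambda) <= C int A(f) (potential_modular).

    If nabla_2 holds only near 0 but the integral of phi^(-rho) converges at
    infinity, then potential_bounded applies without truncation, so If is
    bounded; after enlarging lambda only levels t below the nabla_2 threshold
    contribute (admissible_levels).  The norm inequality follows by
    homogeneity, f being divided by a large constant to bring the modular of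
    the potential below 1. *)

(** * Potentials with a kernel of weak type *)

Lemma integral_indicE d (T : measurableType d) (R : realType)
    (mu : {measure set T -> \bar R}) (S : set T) (g : T -> R) :
  \int[mu]_(s in S) (g s)%:E = \int[mu]_s (g s * \1_S s)%:E.
Proof.
rewrite integral_mkcond; apply: eq_integral => s _.
rewrite patchE indicE; case: ifPn => _ /=; first by rewrite mulr1.
by rewrite mulr0.
Qed.

Definition cutoff {R : realType} (tau s : R) : R := if (tau < s)%R then s else 0%R.

Lemma cutoff_ge0 {R : realType} (tau s : R) : (0 <= s)%R -> (0 <= cutoff tau s)%R.
Proof. by rewrite /cutoff; case: ifP. Qed.

(** Truncation of the kernel at height tau: the second term is the part whose
    integral the kernel hypotheses below control. *)
Lemma le_cutoff {R : realType} (tau s : R) :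
  (0 <= tau)%R -> (s <= tau + cutoff tau s)%R.
Proof. by rewrite /cutoff; case: (ltP tau s) => ? ?; lra. Qed.

Lemma cutoff_le {R : realType} (tau s : R) : (0 <= s)%R -> (cutoff tau s <= s)%R.
Proof. by rewrite /cutoff; case: (ltP tau s) => ? ?; lra. Qed.

Lemma measurable_cutoff d (T : measurableType d) (R : realType) (f g : T -> R) :
  measurable_fun setT f -> measurable_fun setT g ->
  measurable_fun setT (fun x => cutoff (f x) (g x)).
Proof.
move=> mf mg; apply: measurable_fun_ifT => //; exact: measurable_fun_ltr.
Qed.

Lemma measurable_inv (R : realType) : measurable_fun setT (@GRing.inv R).
Proof.
have -> : @GRing.inv R =
    fun x => (if 0 <= x then x `^ (-1) else - ((- x) `^ (-1)))%R.
  apply/funext => x; case: ifPn => [x0|]; first by rewrite powR_inv1.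
  by rewrite -ltNge => x0; rewrite powR_inv1 ?oppr_ge0 ?ltW// invrN opprK.
apply: measurable_fun_ifT; first exact: measurable_fun_ler.
- exact: measurable_powR.
- apply: measurable_funN; apply: (measurableT_comp (measurable_powR _)).
  exact: measurable_funN.
Qed.

Section potential.
Context d (X : measurableType d) (R : realType)
  (mu : {sigma_finite_measure set X -> \bar R}).
Variables (k : X -> X -> R) (rho c : R).
Hypothesis k_ge0 : forall x y, (0 <= k x y)%R.
Hypothesis mk : measurable_fun setT (fun z : X * X => k z.1 z.2).
Hypothesis rho_gt0 : (0 < rho)%R.
Hypothesis c_ge0 : (0 <= c)%R.
Hypothesis kr : forall x tau, (0 < tau)%R ->
  \int[mu]_y (cutoff tau (k x y))%:E <= (c * tau `^ (- rho))%:E.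
Hypothesis kl : forall y tau, (0 < tau)%R ->
  \int[mu]_x (cutoff tau (k x y))%:E <= (c * tau `^ (- rho))%:E.

Variable phi : R -> R.
Hypothesis phi_nd : {homo phi : s t / (s <= t)%R}.
Hypothesis phi_gt0 : forall t, (0 < t)%R -> (0 < phi t)%R.
Hypothesis phi_ge0 : forall t, (0 <= phi t)%R.

Notation leb := (@lebesgue_measure R).

Definition potential (f : X -> R) (x : X) : \bar R :=
  \int[mu]_y (f y * k x y)%:E.

Let mphi : measurable_fun setT phi.
Proof. exact: nondecreasing_measurable. Qed.

Let mkx x : measurable_fun setT (k x).
Proof. exact: (measurableT_comp mk (pair1_measurable x)). Qed.

Let mky y : measurable_fun setT (k^~ y).
Proof. exact: (measurableT_comp mk (pair2_measurable y)). Qed.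

(** A Young-type inequality: either b <= N phi(a), and the first term is enough,
    or b exceeds N phi(s) for every s < a, and the integral is at least a b. *)
Let mul_le_level_integral (N : R) (S : set R) (a b : R) : (0 < N)%R -> measurable S ->
  (0 <= a)%R -> (0 <= b)%R -> `]0%R, a[ `<=` S ->
  (a * b)%:E <= (N * (a * phi a))%:E +
     \int[leb]_s (cutoff (N * phi s) b * \1_S s)%:E.
Proof.
move=> N0 mS a0 b0 aS.
have int0 : 0 <= \int[leb]_s (cutoff (N * phi s) b * \1_S s)%:E.
  apply: integral_ge0 => s _; rewrite lee_fin mulr_ge0 ?cutoff_ge0//.
have [bN|Nb] := leP b (N * phi a)%R.
  rewrite -[leLHS]adde0 leeD// lee_fin.
  by rewrite mulrCA ler_wpM2l.
rewrite -[leLHS]add0e leeD//.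
  by rewrite lee_fin !mulr_ge0// ltW.
apply: (@le_trans _ _ (\int[leb]_(s in `]0%R, a[) (cst b%:E s))).
  rewrite integral_cst//= lebesgue_measure_itv/= lte_fin.
  move: a0; rewrite le_eqVlt => /predU1P[<-|a0]; first by rewrite ltxx mul0r mule0.
  by rewrite a0 oppr0 adde0 -EFinM lee_fin mulrC.
rewrite (integral_indicE _ _ (cst b)).
apply: ge0_le_integral => //.
- by move=> s _ /=; rewrite lee_fin mulr_ge0.
- apply/measurable_EFinP; apply: measurable_funM => //.
- apply/measurable_EFinP; apply: measurable_funM => //.
  apply: measurable_cutoff => //; exact: measurable_funM.
- move=> s _; rewrite lee_fin !indicE.
  case: (boolP (s \in `]0%R, a[%classic)) => [sa|_]; last first.
    by rewrite mulr0 mulr_ge0 ?cutoff_ge0.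
  have := set_mem sa; rewrite /= in_itv/= => /andP[s0 sa'].
  rewrite (mem_set (aS _ (set_mem sa))) !mulr1 /cutoff ifT//.
  by rewrite (le_lt_trans _ Nb)// ler_wpM2l ?(ltW N0)// phi_nd// ltW.
Qed.

(** The case of f bounded by t, with S = (0, t) and N = H(t); the case
    S = (0, oo) is the sup bound used when H is bounded.  The estimate plays
    the role of Hoelder's inequality between an Orlicz space and its
    conjugate. *)
Lemma potential_bounded (N : R) (S : set R) (f : X -> R) : (0 < N)%R ->
  measurable S -> S `<=` [set s | 0 < s]%R ->
  \int[leb]_(s in S) (phi s `^ (- rho))%:E <= (N `^ (1 + rho))%:E ->
  measurable_fun setT f -> (forall y, 0 <= f y)%R ->
  (forall y, `]0%R, f y[ `<=` S) ->
  \int[mu]_y (f y * phi (f y))%:E <= 1 ->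
  forall x, potential f x <= ((1 + c) * N)%:E.
Proof.
move=> N0 mS S0 SN mf f0 fS f1 x.
pose F (z : X * R) := (cutoff (N * phi z.2) (k x z.1) * \1_S z.2)%:E.
have mF : measurable_fun setT F.
  apply/measurable_EFinP; apply: measurable_funM.
    apply: measurable_cutoff.
      apply: measurable_funM => //; exact: (measurableT_comp mphi measurable_snd).
    exact: (measurableT_comp (mkx x) measurable_fst).
  exact: (measurableT_comp (measurable_indic _) measurable_snd).
have F0 z : 0 <= F z by rewrite lee_fin mulr_ge0 ?cutoff_ge0.
have mfphi : measurable_fun setT (fun y => (f y * phi (f y))%:E).
  apply/measurable_EFinP; apply: measurable_funM => //.
  exact: measurableT_comp.
have fphi0 y : 0 <= (f y * phi (f y))%:E by rewrite lee_fin mulr_ge0.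
apply: (@le_trans _ _ (\int[mu]_y (N%:E * (f y * phi (f y))%:E +
     \int[leb]_s F (y, s)))).
  apply: ge0_le_integral => //.
  - by move=> y _; rewrite lee_fin mulr_ge0.
  - by apply/measurable_EFinP; apply: measurable_funM.
  - apply: emeasurable_funD.
      exact: measurable_funeM.
    exact: (@measurable_fun_fubini_tonelli_F _ _ _ _ _ leb F).
  - by move=> y _; rewrite -EFinM; exact: mul_le_level_integral.
rewrite ge0_integralD//; last 4 first.
- by move=> y _; rewrite mule_ge0// lee_fin ltW.
- exact: measurable_funeM.
- by move=> y _; exact: integral_ge0.
- exact: (@measurable_fun_fubini_tonelli_F _ _ _ _ _ leb F).
rewrite ge0_integralZl// ?lee_fin ?(ltW N0)// mulrDl mul1r EFinD leeD//.
  by rewrite -[leRHS]mule1 lee_wpmul2l// lee_fin ltW.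
rewrite (@fubini_tonelli _ _ _ _ _ mu leb F)//.
have sS s : S s -> (0 < N * phi s)%R by move=> /S0 /= s0; rewrite mulr_gt0 ?phi_gt0.
have mphir : measurable_fun setT (fun s => (phi s `^ (- rho))%R).
  exact: (measurableT_comp (measurable_powR _) mphi).
apply: (@le_trans _ _ (\int[leb]_s ((c * N `^ (- rho))%:E *
    (phi s `^ (- rho) * \1_S s)%:E))).
  apply: ge0_le_integral => //.
  - by move=> s _; exact: integral_ge0.
  - exact: (@measurable_fun_fubini_tonelli_G _ _ _ _ _ mu F).
  - apply: measurable_funeM; apply/measurable_EFinP; exact: measurable_funM.
  - move=> s _; rewrite /F /= indicE; case: (boolP (s \in S)) => sS'.
      rewrite mulr1; under eq_integral do rewrite mulr1.
      apply: (le_trans (kr _ _)); first exact/sS/set_mem.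
      by rewrite -EFinM lee_fin powRM ?(ltW N0)// mulrA.
    rewrite mulr0 mule0.
    by under eq_integral do rewrite mulr0; rewrite integral0.
rewrite ge0_integralZl//; last 3 first.
- by apply/measurable_EFinP; exact: measurable_funM.
- by move=> s _; rewrite lee_fin mulr_ge0// powR_ge0.
- by rewrite lee_fin mulr_ge0// powR_ge0.
rewrite -integral_indicE.
apply: (@le_trans _ _ ((c * N `^ (- rho))%:E * (N `^ (1 + rho))%:E)).
  by rewrite lee_wpmul2l// lee_fin mulr_ge0// powR_ge0.
rewrite -EFinM lee_fin -mulrA -powRD ?(gt_eqF N0) ?implybT//.
rewrite (_ : (- rho + (1 + rho) = 1)%R); last by lra.
by rewrite powRr1 ?(ltW N0).
Qed.

Lemma measurable_potential (f : X -> R) : measurable_fun setT f ->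
  (forall y, 0 <= f y)%R -> measurable_fun setT (potential f).
Proof.
move=> mf f0.
pose F (z : X * X) := (f z.2 * k z.1 z.2)%:E.
apply: (@measurable_fun_fubini_tonelli_F _ _ _ _ _ mu F).
  apply/measurable_EFinP; apply: measurable_funM => //.
  exact: (measurableT_comp mf measurable_snd).
by move=> z; rewrite lee_fin mulr_ge0.
Qed.

(** Where f > t, phi(t) <= phi(f), so phi(t) f <= f phi(f) = A(f). *)
Lemma part_above_integral (t : R) (f : X -> R) : (0 < t)%R ->
  measurable_fun setT f -> (forall y, 0 <= f y)%R ->
  \int[mu]_y (f y * phi (f y))%:E <= 1 ->
  \int[mu]_y (cutoff t (f y))%:E <= ((phi t)^-1)%:E.
Proof.
move=> t0 mf f0 f1; have phit := phi_gt0 t0.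
have mfphi : measurable_fun setT (fun y => (f y * phi (f y))%:E).
  apply/measurable_EFinP; apply: measurable_funM => //.
  exact: measurableT_comp.
apply: (@le_trans _ _ (\int[mu]_y (((phi t)^-1)%:E * (f y * phi (f y))%:E))).
  apply: ge0_le_integral => //.
  - by move=> y _; rewrite lee_fin cutoff_ge0.
  - by apply/measurable_EFinP; exact: measurable_cutoff.
  - exact: measurable_funeM.
  - move=> y _; rewrite -EFinM lee_fin /cutoff; case: ifPn => [tf|_].
      rewrite mulrC -mulrA ler_peMr// ler_pdivlMr// mul1r.
      by rewrite phi_nd// ltW.
    by rewrite !mulr_ge0// invr_ge0 ltW.
rewrite ge0_integralZl//.
- rewrite -[leRHS]mule1; apply: lee_wpmul2l => //.
  by rewrite lee_fin invr_ge0 ltW.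
- by move=> y _; rewrite lee_fin mulr_ge0.
- by rewrite lee_fin invr_ge0 ltW.
Qed.

(** The part of f below t contributes at most (1 + c) N.  For the part above
    t, the kernel is cut at sg = N phi(t)/2: since that part has integral at
    most 1/phi(t), the low part of the kernel contributes at most N/2.  Only
    the product G of the two high parts is left, and Markov's inequality
    applies to it. *)
Lemma potential_weak_type (N t : R) (f : X -> R) : (0 < N)%R -> (0 < t)%R ->
  \int[leb]_(s in `]0%R, t[) (phi s `^ (- rho))%:E <= (N `^ (1 + rho))%:E ->
  measurable_fun setT f -> (forall y, 0 <= f y)%R ->
  \int[mu]_y (f y * phi (f y))%:E <= 1 ->
  mu [set x | ((2 + c) * N)%:E <= potential f x] <=
    (c * 2 `^ (1 + rho) / t)%:E * \int[mu]_y (cutoff t (f y))%:E.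
Proof.
move=> N0 t0 Nt mf f0 f1; have phit := phi_gt0 t0.
(* phi^(-rho) is nonincreasing, hence at least phi(t)^(-rho) on (0, t) *)
have tN : (t * phi t `^ (- rho) <= N `^ (1 + rho))%R.
  rewrite -lee_fin; apply: le_trans Nt.
  have mphir : measurable_fun setT (fun s => (phi s `^ (- rho))%:E).
    apply/measurable_EFinP; exact: (measurableT_comp (measurable_powR _) mphi).
  apply: (@le_trans _ _
      (\int[leb]_(s in `]0%R, t[) (cst (phi t `^ (- rho))%:E s))).
    rewrite integral_cst//= lebesgue_measure_itv/= lte_fin t0 oppr0 adde0.
    by rewrite -EFinM mulrC.
  apply: ge0_le_integral => //.
  - by move=> s _; rewrite lee_fin powR_ge0.
  - exact: measurable_funTS.
  - move=> s /=; rewrite in_itv/= => /andP[s0 st].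
    rewrite lee_fin !powRN lef_pV2 ?posrE ?powR_gt0 ?phi_gt0//.
    by rewrite ge0_ler_powR ?nnegrE// ?(ltW rho_gt0)// phi_nd// ltW.
pose sg := (N * phi t / 2)%R.
have sg0 : (0 < sg)%R by rewrite divr_gt0 ?mulr_gt0.
set F := \int[mu]_y (cutoff t (f y))%:E.
have F0 : 0 <= F by apply: integral_ge0 => y _; rewrite lee_fin cutoff_ge0.
have Fphi : F <= ((phi t)^-1)%:E by exact: part_above_integral.
pose f2 y := (f y - cutoff t (f y))%R.
have mcf : measurable_fun setT (fun y => cutoff t (f y)) by exact: measurable_cutoff.
have mf2 : measurable_fun setT f2 by exact: measurable_funB.
have f20 y : (0 <= f2 y)%R by rewrite subr_ge0 cutoff_le.
have f2f y : (f2 y <= f y)%R by rewrite gerBl cutoff_ge0.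
have f2t y : (f2 y <= t)%R.
  rewrite /f2 /cutoff; case: ifPn => [_|]; first by rewrite subrr ltW.
  by rewrite subr0 -leNgt.
have f21 : \int[mu]_y (f2 y * phi (f2 y))%:E <= 1.
  apply: le_trans f1; apply: ge0_le_integral => //.
  - by move=> y _; rewrite lee_fin mulr_ge0.
  - apply/measurable_EFinP; apply: measurable_funM => //; exact: measurableT_comp.
  - apply/measurable_EFinP; apply: measurable_funM => //; exact: measurableT_comp.
  - by move=> y _; rewrite lee_fin ler_pM// phi_nd.
have P2 x : potential f2 x <= ((1 + c) * N)%:E.
  apply: (@potential_bounded N `]0%R, t[) => //.
    by move=> s /=; rewrite in_itv/= => /andP[].
  by move=> y s /=; rewrite !in_itv/= => /andP[-> /lt_le_trans]; exact.
pose H (z : X * X) := (cutoff t (f z.2) * cutoff sg (k z.1 z.2))%:E.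
pose G x := \int[mu]_y H (x, y).
have H0 z : 0 <= H z by rewrite lee_fin mulr_ge0 ?cutoff_ge0.
have mH : measurable_fun setT H.
  apply/measurable_EFinP; apply: measurable_funM.
    exact: (measurableT_comp mcf measurable_snd).
  exact: measurable_cutoff.
have mG : measurable_fun setT G.
  exact: (@measurable_fun_fubini_tonelli_F _ _ _ _ _ mu H).
have G0 x : 0 <= G x by apply: integral_ge0.
have potE x : potential f x <= ((1 + c) * N)%:E + ((N / 2)%:E + G x).
  apply: (@le_trans _ _ (\int[mu]_y ((f2 y * k x y)%:E +
      (sg%:E * (cutoff t (f y))%:E + H (x, y))))).
    apply: ge0_le_integral => //.
    - by move=> y _; rewrite lee_fin mulr_ge0.
    - by apply/measurable_EFinP; exact: measurable_funM.
    - apply/measurable_EFinP; apply: measurable_funD; first exact: measurable_funM.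
      apply: measurable_funD; first exact: measurable_funM.
      by apply: measurable_funM => //=; exact: measurable_cutoff.
    - move=> y _; rewrite /H /f2 /= -!EFinM -!EFinD lee_fin.
      have := le_cutoff (k x y) (ltW sg0); have := cutoff_ge0 t (f0 y).
      by move: (cutoff _ _) (cutoff _ _) => u v; nra.
  have mH' : measurable_fun setT (fun y => H (x, y)).
    exact: (measurableT_comp mH (pair1_measurable x)).
  have msg : measurable_fun setT (fun y => sg%:E * (cutoff t (f y))%:E).
    by apply: measurable_funeM; exact/measurable_EFinP.
  have sgp y : 0 <= sg%:E * (cutoff t (f y))%:E.
    by rewrite mule_ge0// lee_fin ?cutoff_ge0// ltW.
  rewrite ge0_integralD//; last 4 first.
  - by move=> y _; rewrite lee_fin mulr_ge0.
  - by apply/measurable_EFinP; exact: measurable_funM.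
  - by move=> y _; rewrite adde_ge0.
  - exact: emeasurable_funD.
  rewrite leeD//; first exact: P2.
  rewrite ge0_integralD// leeD//.
  rewrite ge0_integralZl//; last 3 first.
  - exact/measurable_EFinP.
  - by move=> y _; rewrite lee_fin cutoff_ge0.
  - by rewrite lee_fin ltW.
  apply: (@le_trans _ _ (sg%:E * ((phi t)^-1)%:E)).
    by apply: lee_wpmul2l => //; rewrite lee_fin ltW.
  rewrite -EFinM lee_fin /sg.
  by rewrite (_ : N * phi t / 2 / phi t = N / 2)%R//; field; rewrite gt_eqF.
have sub : [set x | ((2 + c) * N)%:E <= potential f x] `<=`
    setT `&` [set x | (N / 2)%:E <= `|G x|].
  move=> x /= h; split => //; rewrite gee0_abs//.
  move: (le_trans h (potE x)).
  case: (G x) (G0 x) => [g| |] // _; last by move=> _; exact: leey.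
  by rewrite -!EFinD !lee_fin; lra.
have mE : measurable [set x | ((2 + c) * N)%:E <= potential f x].
  rewrite -[X in measurable X]setTI; apply: emeasurable_fun_c_infty => //.
  exact: measurable_potential.
have mG' : measurable (setT `&` [set x | (N / 2)%:E <= `|G x|]).
  apply: emeasurable_fun_c_infty => //.
  exact: measurableT_comp.
apply: (le_trans (le_measure _ _ _ sub)); rewrite ?inE//.
have N20 : (0 < N / 2)%R by rewrite divr_gt0.
have markov := @le_integral_abse _ _ _ mu setT measurableT G (N / 2)%R mG N20.
have IG : \int[mu]_x `|G x| <= (c * sg `^ (- rho))%:E * F.
  under eq_integral do rewrite gee0_abs//.
  rewrite /G (@fubini_tonelli _ _ _ _ _ mu mu H)//.
  rewrite /F -ge0_integralZl//; last 3 first.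
  - exact/measurable_EFinP.
  - by move=> y _; rewrite lee_fin cutoff_ge0.
  - by rewrite lee_fin mulr_ge0// powR_ge0.
  apply: ge0_le_integral => //.
  - by move=> y _; exact: integral_ge0.
  - exact: (@measurable_fun_fubini_tonelli_G _ _ _ _ _ mu H).
  - by apply: measurable_funeM; exact/measurable_EFinP.
  - move=> y _; rewrite /H /=.
    under eq_integral do rewrite EFinM.
    rewrite ge0_integralZl//.
    + by rewrite muleC; apply: lee_wpmul2r; [rewrite lee_fin cutoff_ge0|exact: kl].
    + by apply/measurable_EFinP; exact: measurable_cutoff.
    + by move=> x _; rewrite lee_fin cutoff_ge0.
    + by rewrite lee_fin cutoff_ge0.
(* The exponents match: N^(-1) sg^(-rho) is a multiple of
   N^(-1-rho) phi(t)^(-rho), which is at most 1/t by tN. *)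
rewrite -(@lee_pmul2l _ (N / 2)%:E)// ?lte_fin//.
apply: (le_trans markov); apply: (le_trans IG).
rewrite muleA; apply: lee_wpmul2r => //.
rewrite -EFinM lee_fin /sg.
rewrite (_ : N / 2 * (c * 2 `^ (1 + rho) / t) =
  c * (N / 2 * (2 `^ (1 + rho) / t)))%R; last by ring.
apply: ler_wpM2l => //.
rewrite -mulrA powRM ?(ltW N0)// ?divr_ge0//.
rewrite powRM// ?invr_ge0//.
have -> : (2^-1 `^ (- rho) = 2 `^ rho :> R)%R.
  by rewrite -powR_inv1// -powRrM mulN1r opprK.
have e2 : (2 `^ (1 + rho) = 2 * 2 `^ rho :> R)%R.
  by rewrite powRD ?powRr1// pnatr_eq0 implybT.
have eN : (N `^ (1 + rho) * N `^ (- rho) = N)%R.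
  by rewrite -powRD ?(gt_eqF N0) ?implybT// addrK powRr1// ltW.
rewrite [leRHS]mulrA ler_pdivlMr// e2.
have -> : (N / 2 * (2 * 2 `^ rho) = N * 2 `^ rho)%R by field.
rewrite -[in leRHS]eN.
have := powR_gt0 rho (ltr0n R 2); have := powR_gt0 (- rho) N0.
move: (N `^ _)%R (N `^ _)%R (phi t `^ _)%R (2 `^ _)%R tN => a b u v tu a0 v0.
rewrite (_ : a * (u * v) * t = t * u * (a * v))%R; last by ring.
by rewrite -[leRHS]mulrA ler_wpM2r// mulr_ge0// ltW.
Qed.

(** D collects the levels t at which phi has controlled growth; no other level
    is reached by the potential.  Tonelli's theorem turns the left-hand side
    into an integral over t of phi(t) times the measure of a superlevel set,
    to which the weak-type bound applies, and a second exchange of integrals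
    leaves the integral of phi(t)/t over the levels below f(y). *)
Lemma potential_modular (h : R -> R) (D : set R) (kappa CJ : R) (f : X -> R) :
  measurable_fun setT h -> (forall t, 0 < t -> 0 < h t)%R ->
  (forall t, (0 < t)%R ->
    \int[leb]_(s in `]0%R, t[) (phi s `^ (- rho))%:E <= (h t `^ (1 + rho))%:E) ->
  measurable D -> D `<=` [set t | 0 < t]%R -> (0 <= CJ)%R ->
  (forall s, (0 <= s)%R -> \int[leb]_(t in D) (cutoff t s * (phi t / t))%:E <=
     (CJ * (s * phi s))%:E) ->
  (2 + c <= kappa)%R ->
  measurable_fun setT f -> (forall y, 0 <= f y)%R ->
  \int[mu]_y (f y * phi (f y))%:E <= 1 ->
  (forall x t, (0 < t)%R -> (kappa * h t)%:E <= potential f x -> D t) ->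
  \int[mu]_x \int[leb]_(t in `]0%R, +oo[)
      (if ((kappa * h t)%:E <= potential f x)%E then phi t else 0%R)%:E <=
    (c * 2 `^ (1 + rho) * CJ)%:E * \int[mu]_y (f y * phi (f y))%:E.
Proof.
move=> mh h0 hE mD D0 CJ0 hJ kc mf f0 f1 hD.
pose K := (c * 2 `^ (1 + rho))%R.
have K0 : (0 <= K)%R by rewrite mulr_ge0// powR_ge0.
have mpot := measurable_potential mf f0.
have i0 (t : R) (S : set R) : (0 <= \1_S t :> R)%R by rewrite indicE.
pose P (z : X * R) := ((if ((kappa * h z.2)%:E <= potential f z.1)%E then phi z.2
  else 0%R) * \1_(`]0%R, +oo[%classic) z.2)%:E.
have P0 z : 0 <= P z by rewrite lee_fin mulr_ge0//; case: ifP.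
have mP : measurable_fun setT P.
  apply/measurable_EFinP; apply: measurable_funM; last first.
    exact: (measurableT_comp (measurable_indic _) measurable_snd).
  apply: measurable_fun_ifT => //.
    apply: measurable_fun_lee.
      apply/measurable_EFinP; apply: measurable_funM => //.
      exact: (measurableT_comp mh measurable_snd).
    exact: (measurableT_comp mpot measurable_fst).
  exact: (measurableT_comp mphi measurable_snd).
pose Q (z : R * X) := (cutoff z.1 (f z.2) * (phi z.1 / z.1) * \1_D z.1)%:E.
have Q0 z : 0 <= Q z.
  rewrite lee_fin indicE; case: (boolP (z.1 \in D)) => zD; last by rewrite mulr0.
  have z0 := D0 _ (set_mem zD).
  by rewrite mulr1 mulr_ge0 ?cutoff_ge0// divr_ge0// ltW.
have mQ : measurable_fun setT Q.
  apply/measurable_EFinP; apply: measurable_funM; last first.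
    exact: (measurableT_comp (measurable_indic _) measurable_fst).
  apply: measurable_funM.
    apply: measurable_cutoff; first exact: measurable_fst.
    exact: (measurableT_comp mf measurable_snd).
  apply: measurable_funM; first exact: (measurableT_comp mphi measurable_fst).
  exact: (measurableT_comp (@measurable_inv R) measurable_fst).
under eq_integral do rewrite (integral_indicE _ _ (fun t => _)).
rewrite (@fubini_tonelli _ _ _ _ _ mu leb P)//.
apply: (@le_trans _ _ (\int[leb]_t (K%:E * \int[mu]_y Q (t, y)))).
  apply: ge0_le_integral => //.
  - by move=> t _; exact: integral_ge0.
  - exact: (@measurable_fun_fubini_tonelli_G _ _ _ _ _ mu P).
  - apply: measurable_funeM.
    exact: (@measurable_fun_fubini_tonelli_F _ _ _ _ _ mu Q).
  - move=> t _; have [tpos|tneg] := ltP 0%R t; last first.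
      rewrite integral0_eq ?mule_ge0 ?lee_fin ?integral_ge0//.
      move=> x _; rewrite /P /= indicE memNset ?mulr0//=.
      by rewrite in_itv/= andbT; apply/negP; rewrite -leNgt.
    set E := [set x | (kappa * h t)%:E <= potential f x].
    have mE : measurable E.
      by rewrite -[X in measurable X]setTI; exact: emeasurable_fun_c_infty.
    have -> : \int[mu]_x P (x, t) = (phi t)%:E * mu E.
      transitivity (\int[mu]_x ((phi t)%:E * (\1_E x)%:E)).
        apply: eq_integral => x _; rewrite /P /= -EFinM; congr EFin.
        rewrite [X in (_ * X)%R]indicE mem_set ?mulr1; last by rewrite /= in_itv/= tpos.
        rewrite indicE; case: ifPn => [xE|/negP xE].
          by rewrite mem_set// mulr1.
        by rewrite memNset// mulr0.
      rewrite ge0_integralZl ?lee_fin//.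
      + by rewrite integral_indic// setIT.
      + apply/measurable_EFinP; exact: measurable_indic.
    have [tD|tD] := pselect (D t); last first.
      rewrite (_ : E = set0); last first.
        by rewrite -subset0 => x /(hD _ _ tpos).
      by rewrite measure0 mule0 mule_ge0 ?lee_fin ?integral_ge0.
    have -> : \int[mu]_y Q (t, y) = (phi t / t)%:E * \int[mu]_y (cutoff t (f y))%:E.
      rewrite -ge0_integralZl//.
      + apply: eq_integral => y _; rewrite /Q /= indicE mem_set// mulr1.
        by rewrite -EFinM mulrC.
      + apply/measurable_EFinP; exact: measurable_cutoff.
      + by move=> y _; rewrite lee_fin cutoff_ge0.
      + by rewrite lee_fin divr_ge0// ltW.
    apply: (@le_trans _ _ ((phi t)%:E * ((K / t)%:E *
        \int[mu]_y (cutoff t (f y))%:E))).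
      apply: lee_wpmul2l; first by rewrite lee_fin.
      apply: le_trans (potential_weak_type (h0 _ tpos) tpos (hE _ tpos) mf f0 f1).
      apply: le_measure; rewrite ?inE//.
        rewrite -[X in measurable X]setTI; exact: emeasurable_fun_c_infty.
      move=> x; apply: le_trans; rewrite lee_fin ler_wpM2r// ltW// h0//.
    rewrite !muleA -!EFinM.
    by rewrite (_ : phi t * (K / t) = K * (phi t / t))%R//; ring.
rewrite ge0_integralZl//; last 2 first.
- exact: (@measurable_fun_fubini_tonelli_F _ _ _ _ _ mu Q).
- by move=> t _; exact: integral_ge0.
rewrite -/K (EFinM K CJ) -muleA; apply: lee_wpmul2l; first by rewrite lee_fin.
rewrite (@fubini_tonelli _ _ _ _ _ leb mu Q)//.
have mfphi : measurable_fun setT (fun y => (f y * phi (f y))%:E).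
  apply/measurable_EFinP; apply: measurable_funM => //.
  exact: measurableT_comp.
rewrite -ge0_integralZl//; last by move=> y _; rewrite lee_fin mulr_ge0.
apply: ge0_le_integral => //.
- by move=> y _; exact: integral_ge0.
- exact: (@measurable_fun_fubini_tonelli_G _ _ _ _ _ leb Q).
- exact: measurable_funeM.
- move=> y _; apply: le_trans (hJ _ (f0 y)).
  by rewrite (integral_indicE leb D (fun t => cutoff t (f y) * (phi t / t))%R).
Qed.

End potential.

(** * Dyadic summation *)

Lemma dyadic_layer (R : realType) (x : R) : (1 < x)%R ->
  exists j : nat, (2 ^+ j < x <= 2 ^+ j.+1)%R.
Proof.
move=> x1.
have ex : exists j, (x <= 2 ^+ j.+1)%R.
  exists (Num.truncn x); apply: ltW; apply: (lt_le_trans (truncnS_gt x)).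
  rewrite -natrX ler_nat; exact: (ltnW (ltn_expl _ _)).
exists (ex_minn ex); case: ex_minnP => j xj minj; rewrite xj andbT.
case: j xj minj => [|j] xj minj; first by rewrite expr0.
by rewrite ltNge; apply/negP => /minj; rewrite ltnn.
Qed.

(** A function bounded by a j on the j-th layer of a cover, with masses
    a j * mu (E j) decaying geometrically. *)
Lemma integral_le_geometric d (T : measurableType d) (R : realType)
    (mu : {measure set T -> \bar R}) (D : set T) (f : T -> \bar R)
    (E : nat -> set T) (a : nat -> R) (B z : R) :
  measurable D -> measurable_fun D f -> (forall x, D x -> 0 <= f x) ->
  (forall j, measurable (E j)) -> D `<=` \bigcup_j E j ->
  (forall j, 0 <= a j)%R -> (forall j x, D x -> E j x -> f x <= (a j)%:E) ->
  (0 <= z < 1)%R -> (forall j, (a j)%:E * mu (E j) <= (B * z ^+ j)%:E) ->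
  \int[mu]_(x in D) f x <= (B / (1 - z))%:E.
Proof.
move=> mD mf f0 mE DE a0 fa /andP[z0 z1] aE.
have i0 j x : (0 <= \1_(E j) x :> R)%R by rewrite indicE.
have t0 j x : 0 <= (a j * \1_(E j) x)%:E by rewrite lee_fin mulr_ge0.
apply: (@le_trans _ _ (\int[mu]_(x in D) \sum_(j <oo) (a j * \1_(E j) x)%:E)).
  apply: ge0_le_integral => //.
    apply: ge0_emeasurable_sum => // j _.
    by apply/measurable_EFinP; apply: measurable_funM.
  move=> x Dx; have [j _ Ejx] := DE _ Dx.
  apply: (le_trans (fa _ _ Dx Ejx)).
  apply: (@le_trans _ _ (\sum_(0 <= i < j.+1) (a i * \1_(E i) x)%:E)).
    rewrite big_nat_recr//= -[leLHS]add0e leeD ?sume_ge0//.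
    by rewrite indicE mem_set// mulr1.
  exact: nneseries_lim_ge.
rewrite integral_nneseries//; last first.
  by move=> j; apply/measurable_EFinP; apply: measurable_funM.
apply: (@le_trans _ _ (\sum_(j <oo) (B * z ^+ j)%:E)).
  apply: lee_nneseries => [j _ _|j _]; first exact: integral_ge0.
  apply: le_trans (aE j).
  under eq_integral do rewrite EFinM.
  rewrite ge0_integralZl//.
  - rewrite integral_indic//; apply: lee_wpmul2l; first by rewrite lee_fin.
    by apply: le_measure; rewrite ?inE//; exact: measurableI.
  - exact/measurable_EFinP.
  - by rewrite lee_fin.
have cv := @cvg_geometric_series R B z _.
rewrite (_ : \sum_(j <oo) _ = (B / (1 - z))%:E)//.
apply/cvg_lim => //.
rewrite (_ : (fun n => _) = EFin \o series (geometric B z)).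
  apply: cvg_EFin; [exact: nearW|apply: cv].
  by rewrite ger0_norm.
apply/funext => n /=; rewrite -sumEFin; apply: eq_bigr => i _.
by rewrite /geometric /=.
Qed.

(** The integral of a nonnegative function is a supremum over the simple
    functions below it, hence monotone on arbitrary functions; the bound on
    the modular of the Sobolev conjugate is obtained in this way. *)
Lemma le_integralT d (T : measurableType d) (R : realType)
    (mu : {measure set T -> \bar R}) (f g : T -> \bar R) :
  (forall x, 0 <= f x) -> (forall x, f x <= g x) ->
  \int[mu]_x f x <= \int[mu]_x g x.
Proof.
move=> f0 fg; rewrite !ge0_integralTE//; last by move=> x; exact: le_trans (fg x).
apply: ge_ereal_sup => _ [h /= hf <-]; apply: ereal_sup_ubound.
by exists h => //= x; exact: le_trans (fg x).
Qed.

(** * The slope of a Young function and its Sobolev conjugate *)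

Section young_slope.
Context {R : realType}.
Variable A : R -> \bar R.
Hypotheses (youngA : young A) (finA : finite_valued A).

Notation leb := (@lebesgue_measure R).

(** The value 0 on the negative half-line makes the slope nondecreasing, hence
    measurable, on the whole line. *)
Definition slope (t : R) : R := if (0 < t)%R then (fine (A t) / t)%R else 0%R.

Lemma youngE t : (0 <= t)%R -> A t = (t * slope t)%:E.
Proof.
have [A0 _ _ _ _] := youngA.
rewrite le_eqVlt => /predU1P[<-|t0]; first by rewrite mul0r A0.
by rewrite /slope t0 mulrC divfK ?gt_eqF// fineK// finA// ltW.
Qed.

Lemma slope_ge0 t : (0 <= slope t)%R.
Proof.
have [_ Age0 _ _ _] := youngA; rewrite /slope; case: ifPn => // t0.
by rewrite divr_ge0// ?fine_ge0 ?Age0 ?(ltW t0).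
Qed.

Lemma slope_nd : {homo slope : s t / (s <= t)%R}.
Proof.
have [A0 Age0 cvx _ _] := youngA.
move=> s t st; have [s0|s0] := ltP 0%R s; last first.
  by rewrite {1}/slope ltNge s0/= slope_ge0.
have t0 := lt_le_trans s0 st.
have st1 : (0 <= s / t <= 1)%R by rewrite divr_ge0 ?(ltW s0) ?(ltW t0)//= ler_pdivrMr ?mul1r.
have := cvx t 0%R (s / t)%R (ltW t0) (lexx _) st1.
rewrite mulr0 addr0 divfK ?gt_eqF// A0 mule0 adde0 youngE ?(ltW s0)//.
rewrite youngE ?(ltW t0)// -EFinM lee_fin mulrA divfK ?gt_eqF//.
by rewrite ler_pM2l.
Qed.

Variables (n : nat) (alpha : R).
Hypotheses (alpha_gt0 : (0 < alpha)%R) (alpha_ltn : (alpha < n%:R)%R).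

Let rho := (alpha / (n%:R - alpha))%R.

Let rho_gt0 : (0 < rho)%R.
Proof. by rewrite divr_gt0// subr_gt0. Qed.

Hypothesis conv0 : sobolev_conv0 n alpha A.

(** If A vanished at some t > 0 it would vanish on (0, t), and the integrand in
    the convergence condition at 0 would be infinite there. *)
Lemma slope_gt0 t : (0 < t)%R -> (0 < slope t)%R.
Proof.
move=> t0; rewrite lt_neqAle slope_ge0 andbT eq_sym; apply/negP => /eqP st0.
have [a a0] := conv0.
pose r := Order.min a t.
have r0 : (0 < r)%R by rewrite lt_min a0.
suff : \int[leb]_(s in `]0%R, a[) sobolev_integrand n alpha A s = +oo by move=> ->.
apply/eqP; rewrite -leye_eq.
have Ay s : (0 < s < r)%R -> sobolev_integrand n alpha A s = +oo.
  move=> /andP[s0 sr]; rewrite /sobolev_integrand youngE ?(ltW s0)//.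
  have -> : slope s = 0%R.
    apply/eqP; rewrite eq_le slope_ge0 andbT -st0 slope_nd//.
    by rewrite (le_trans (ltW sr))// ge_min lexx orbT.
  by rewrite mulr0 inve0 gt0_muley ?lte_fin// poweRyr// gt_eqF.
apply: (@le_trans _ _ (\int[leb]_(s in `]0%R, r[) sobolev_integrand n alpha A s)).
  rewrite (@eq_integral _ _ _ leb _ (cst +oo)); last first.
    by move=> s; rewrite inE/= in_itv/= => /Ay.
  rewrite integral_cst//= lebesgue_measure_itv/= lte_fin r0 oppr0 adde0.
  by rewrite gt0_mulye// lte_fin.
rewrite integral_mkcond [leRHS]integral_mkcond.
have ra s : s \in (`]0%R, r[%classic : set R) -> s \in (`]0%R, a[%classic : set R).
  rewrite !inE/= !in_itv/= => /andP[-> sr] /=.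
  by rewrite (lt_le_trans sr)// ge_min lexx.
apply: le_integralT => s; rewrite !patchE.
  by case: ifP => // _; exact: poweR_ge0.
case: ifPn => [/ra -> //|_].
by case: ifP => // _; exact: poweR_ge0.
Qed.

Lemma sobolev_integrandE t : (0 < t)%R ->
  sobolev_integrand n alpha A t = (slope t `^ (- rho))%:E.
Proof.
move=> t0; have st0 := slope_gt0 t0.
rewrite /sobolev_integrand youngE ?(ltW t0)// inver gt_eqF ?mulr_gt0//.
rewrite -EFinM invfM mulrA divff ?gt_eqF// mul1r poweR_EFin -/rho.
by rewrite -powR_inv1 ?(ltW st0)// -powRrM mulN1r.
Qed.

(** The power n/(n - alpha) = 1 + rho of the function H. *)
Definition conj_integral (t : R) : \bar R :=
  \int[leb]_(s in `]0%R, t[) (slope s `^ (- rho))%:E.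

Lemma measurable_slope : measurable_fun setT slope.
Proof. exact: (nondecreasing_measurable measurableT slope_nd). Qed.

Lemma measurable_slopeN (D : set R) :
  measurable_fun D (fun s => (slope s `^ (- rho))%:E).
Proof.
apply: measurable_funTS; apply/measurable_EFinP.
exact: (measurableT_comp (measurable_powR _) measurable_slope).
Qed.

Lemma slopeN_ni s t : (0 < s)%R -> (s <= t)%R ->
  (slope t `^ (- rho) <= slope s `^ (- rho))%R.
Proof.
move=> s0 st; have t0 := lt_le_trans s0 st.
rewrite !powRN lef_pV2 ?posrE ?powR_gt0 ?slope_gt0//.
by rewrite ge0_ler_powR ?nnegrE ?slope_ge0// ?(ltW rho_gt0)// slope_nd.
Qed.

Lemma sobolev_HE t :
  sobolev_H n alpha A t = conj_integral t `^ ((n%:R - alpha) / n%:R).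
Proof.
rewrite /sobolev_H; congr (_ `^ _); apply: eq_integral => s.
by rewrite inE/= in_itv/= => /andP[s0 _]; rewrite sobolev_integrandE.
Qed.

Lemma conj_integral_ge0 t : 0 <= conj_integral t.
Proof. by apply: integral_ge0 => s _; rewrite lee_fin powR_ge0. Qed.

Lemma conj_integral_nd s t : (s <= t)%R -> conj_integral s <= conj_integral t.
Proof.
move=> st; apply: ge0_subset_integral => //.
- exact: measurable_slopeN.
- by move=> u _; rewrite lee_fin powR_ge0.
- by move=> u /=; rewrite !in_itv/= => /andP[-> /lt_le_trans]; exact.
Qed.

Lemma slopeN_integral_itv s t : (0 < s)%R -> (s <= t)%R ->
  \int[leb]_(u in `[s, t[) (slope u `^ (- rho))%:E <=
    ((t - s) * slope s `^ (- rho))%:E.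
Proof.
move=> s0 st.
apply: (@le_trans _ _ (\int[leb]_(u in `[s, t[) (cst (slope s `^ (- rho))%:E u))).
  apply: ge0_le_integral => //.
  - by move=> u _; rewrite lee_fin powR_ge0.
  - exact: measurable_slopeN.
  - by move=> u /=; rewrite in_itv/= => /andP[su _]; rewrite lee_fin slopeN_ni.
rewrite integral_cst//= lebesgue_measure_itv/= lte_fin.
case: ltgtP st => // [st _|-> _]; first by rewrite -EFinD -EFinM mulrC.
by rewrite mule0 subrr mul0r.
Qed.

Lemma conj_integral_split s t : (0 < s)%R -> (s <= t)%R ->
  conj_integral t = conj_integral s +
    \int[leb]_(u in `[s, t[) (slope u `^ (- rho))%:E.
Proof.
move=> s0 st; rewrite /conj_integral -ge0_integral_setU//.
- congr integral; rewrite -itv_bndbnd_setU// bnd_simp//.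
- exact: measurable_slopeN.
- by move=> u _; rewrite lee_fin powR_ge0.
- apply/disj_setPS => u [/=]; rewrite !in_itv/= => /andP[_ us] /andP[su _].
  by move: (lt_le_trans us su); rewrite ltxx.
Qed.

Lemma conj_integral_lty t : conj_integral t < +oo.
Proof.
have [a a0 aoo] := conv0.
have Ia : conj_integral a < +oo.
  rewrite /conj_integral (@eq_integral _ _ _ leb _ (sobolev_integrand n alpha A))//.
  by move=> s; rewrite inE/= in_itv/= => /andP[s0 _]; rewrite sobolev_integrandE.
have [ta|/ltW at_] := leP t a.
  exact: le_lt_trans (conj_integral_nd ta) Ia.
rewrite (conj_integral_split a0 at_) lte_add_pinfty//.
by rewrite (le_lt_trans (slopeN_integral_itv _ _))// ltry.
Qed.

Lemma conj_integral_fin_num t : conj_integral t \is a fin_num.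
Proof. by rewrite ge0_fin_numE ?conj_integral_lty// conj_integral_ge0. Qed.

Lemma conj_integral_lower t : (0 < t)%R ->
  (t * slope t `^ (- rho))%:E <= conj_integral t.
Proof.
move=> t0.
apply: (@le_trans _ _ (\int[leb]_(u in `]0%R, t[) (cst (slope t `^ (- rho))%:E u))).
  by rewrite integral_cst//= lebesgue_measure_itv/= lte_fin t0 oppr0 adde0 -EFinM mulrC.
apply: ge0_le_integral => //.
- by move=> u _; rewrite lee_fin powR_ge0.
- exact: measurable_slopeN.
- by move=> u /=; rewrite in_itv/= => /andP[u0 ut]; rewrite lee_fin slopeN_ni// ltW.
Qed.

(** Concavity in disguise: the integrand is nonincreasing, so its integral over
    (t, 2 t) does not exceed the one over (0, t). *)
Lemma conj_integral_double t : (0 < t)%R ->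
  conj_integral (2 * t)%R <= 2%:E * conj_integral t.
Proof.
move=> t0; have t2 : (t <= 2 * t)%R by rewrite ler_peMl ?ltW// ltr1n.
rewrite (conj_integral_split t0 t2) mule_natl mule2n leeD//.
apply: le_trans (conj_integral_lower t0).
apply: (le_trans (slopeN_integral_itv t0 t2)).
by rewrite lee_fin (_ : 2 * t - t = t)%R//; ring.
Qed.

Let q := ((n%:R - alpha) / n%:R)%R.

Let n_gt0 : (0 < n%:R :> R)%R.
Proof. exact: lt_trans alpha_ltn. Qed.

Let q_gt0 : (0 < q)%R.
Proof. by rewrite divr_gt0// subr_gt0. Qed.

Let qE : (q * (1 + rho) = 1)%R.
Proof.
rewrite /q /rho; field.
by rewrite !gt_eqF ?subr_gt0.
Qed.

Definition sobolev_h (t : R) : R := (fine (conj_integral t) `^ q)%R.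

Lemma sobolev_hE t : sobolev_H n alpha A t = (sobolev_h t)%:E.
Proof.
by rewrite sobolev_HE -(fineK (conj_integral_fin_num t)) poweR_EFin.
Qed.

Lemma sobolev_h_ge0 t : (0 <= sobolev_h t)%R.
Proof. exact: powR_ge0. Qed.

Lemma sobolev_hX t : conj_integral t = (sobolev_h t `^ (1 + rho))%:E.
Proof.
rewrite /sobolev_h -powRrM qE powRr1 ?fine_ge0 ?conj_integral_ge0//.
by rewrite fineK// conj_integral_fin_num.
Qed.

Lemma sobolev_h_nd : {homo sobolev_h : s t / (s <= t)%R}.
Proof.
move=> s t st; rewrite ge0_ler_powR ?(ltW q_gt0)// ?nnegrE ?fine_ge0 ?conj_integral_ge0//.
by rewrite fine_le ?conj_integral_fin_num ?conj_integral_nd.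
Qed.

Lemma sobolev_h_gt0 t : (0 < t)%R -> (0 < sobolev_h t)%R.
Proof.
move=> t0; rewrite powR_gt0// fine_gt0// conj_integral_lty andbT.
apply: lt_le_trans (conj_integral_lower t0).
by rewrite lte_fin mulr_gt0// powR_gt0// slope_gt0.
Qed.

Lemma measurable_sobolev_h : measurable_fun setT sobolev_h.
Proof. exact: (nondecreasing_measurable measurableT sobolev_h_nd). Qed.

Lemma sobolev_h_double t : (0 < t)%R -> (sobolev_h (2 * t) <= 2 * sobolev_h t)%R.
Proof.
move=> t0; have := conj_integral_double t0.
rewrite -(fineK (conj_integral_fin_num t)) -(fineK (conj_integral_fin_num (2 * t))).
rewrite -EFinM lee_fin => I2.
apply: (@le_trans _ _ ((2 * fine (conj_integral t)) `^ q)%R).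
  by rewrite ge0_ler_powR ?(ltW q_gt0)// nnegrE ?mulr_ge0// fine_ge0// conj_integral_ge0.
rewrite powRM// ?fine_ge0 ?conj_integral_ge0// ler_wpM2r ?powR_ge0//.
rewrite ler1_powR ?ler1n// ler_pdivrMr// mul1r gerBl ltW//.
Qed.

(** Continuity of the integral in its upper bound shows that H takes every
    value below one of its values. *)
Lemma sobolev_h_ivt (w t : R) : (0 <= w)%R -> (0 <= t)%R -> (w <= sobolev_h t)%R ->
  exists2 s, (0 <= s)%R & sobolev_h s = w.
Proof.
move=> w0 t0 wt.
pose f (s : R) : R := (slope s `^ (- rho))%R.
have itvE (s : R) : \int[leb]_(u in `[0%R, s]) (f u)%:E = conj_integral s.
  rewrite (@integral_itv_bndoo _ _ _ (fun u => (f u)%:E) true false)//.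
  exact: measurable_slopeN.
have intf : leb.-integrable `[0%R, t] (EFin \o f).
  apply/integrableP; split; first exact: measurable_slopeN.
  rewrite (@eq_integral _ _ _ leb _ (fun u => (f u)%:E)).
    by rewrite itvE conj_integral_lty.
  by move=> u _; rewrite gee0_abs// lee_fin powR_ge0.
have cf := parameterized_integral_continuous t0 intf.
have pE s : parameterized_integral leb 0%R s f = fine (conj_integral s).
  by rewrite /parameterized_integral /Rintegral itvE.
pose v := (w `^ (1 + rho))%R.
have vt : (v <= fine (conj_integral t))%R.
  rewrite sobolev_hX/= ge0_ler_powR ?nnegrE ?sobolev_h_ge0//.
  by rewrite addr_ge0// ltW.
have [|s] := IVT (v := v) t0 cf.
  rewrite !pE ge_min le_max vt orbT andbT.
  have -> : fine (conj_integral 0) = 0%R.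
    by rewrite /conj_integral set_itvoo0 integral_set0.
  by rewrite powR_ge0.
rewrite in_itv/= => /andP[s0 _]; rewrite pE => sv; exists s => //.
rewrite /sobolev_h sv /v -powRrM mulrC qE powRr1//.
Qed.

Lemma sobolev_conjugate_attained (s : R) : (0 <= s)%R ->
  sobolev_conjugate n alpha A (sobolev_h s) <= A s.
Proof.
move=> s0; rewrite /sobolev_conjugate /sobolev_Hinv.
set S := [set _ | _ in _].
have Ss : S s%:E by exists s => //; split => //; rewrite sobolev_hE.
have S0 : 0 <= ereal_inf S.
  by apply: le_ereal_inf_tmp => _ [r [r0 _] <-]; rewrite lee_fin.
have := ereal_inf_lbound Ss.
case: (ereal_inf S) S0 => [r| |] //; rewrite !lee_fin => r0 rs.
rewrite !youngE// lee_fin ler_pM// ?slope_ge0// slope_nd//.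
Qed.

Lemma sobolev_conjugate_ge0 (w : R) : 0 <= sobolev_conjugate n alpha A w.
Proof.
rewrite /sobolev_conjugate /sobolev_Hinv.
set S := [set _ | _ in _].
have S0 : 0 <= ereal_inf S.
  by apply: le_ereal_inf_tmp => _ [r [r0 _] <-]; rewrite lee_fin.
case: (ereal_inf S) S0 => [r| |] //; rewrite lee_fin => r0.
by rewrite youngE// lee_fin mulr_ge0// slope_ge0.
Qed.

(** If w = H(s), then A*(w) <= A(s) = s phi(s), which is at most the integral
    of phi over (s, 2 s), where H(t) <= H(2 s) <= 2 w.  If w is not a value of
    H, then H stays below w and the right-hand side is the integral of phi
    over (0, oo), which is infinite. *)
Lemma sobolev_conjugate_le (w : R) : (0 <= w)%R ->
  sobolev_conjugate n alpha A w <=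
    \int[leb]_(t in `]0%R, +oo[)
      (if (sobolev_h t <= 2 * w)%R then slope t else 0%R)%:E.
Proof.
move=> w0.
pose g t := (if (sobolev_h t <= 2 * w)%R then slope t else 0%R).
have g0 t : (0 <= g t)%R by rewrite /g; case: ifP => // _; exact: slope_ge0.
have mg : measurable_fun setT g.
  apply: measurable_fun_ifT => //; last exact: measurable_slope.
  apply: measurable_fun_ler => //; exact: measurable_sobolev_h.
have lower (I : interval R) (b : R) : [set` I] `<=` `]0%R, +oo[%classic -> (0 <= b)%R ->
    (forall t, [set` I] t -> b <= g t)%R ->
    b%:E * leb [set` I] <= \int[leb]_(t in `]0%R, +oo[) (g t)%:E.
  move=> I0 b0 bg; rewrite -[leLHS](integral_cst leb)//.
  apply: (@le_trans _ _ (\int[leb]_(t in [set` I]) (g t)%:E)).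
    apply: ge0_le_integral => //.
    apply/measurable_EFinP; exact: measurable_funTS.
  apply: ge0_subset_integral => //.
  - apply/measurable_EFinP; exact: measurable_funTS.
  - by move=> t _; rewrite lee_fin.
have [[s s0 sw]|no] := pselect (exists2 s, (0 <= s)%R & sobolev_h s = w).
  rewrite -{1}sw; apply: (le_trans (sobolev_conjugate_attained s0)).
  move: s0; rewrite le_eqVlt => /predU1P[<-|s0].
    rewrite youngE// mul0r; apply: integral_ge0 => t _; rewrite lee_fin.
    exact: g0.
  apply: (@le_trans _ _ ((slope s)%:E * leb `]s, (2 * s)%R[%classic)); last first.
    apply: (lower `]s, (2 * s)%R[ _ _ (slope_ge0 _)).
    - by move=> t /=; rewrite !in_itv/= andbT => /andP[/(lt_trans s0)].
    - move=> t /=; rewrite in_itv/= => /andP[st ts]; rewrite /g ifT.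
        by rewrite slope_nd// ltW.
      rewrite -sw; apply: le_trans (sobolev_h_double s0).
      exact/sobolev_h_nd/ltW.
  rewrite lebesgue_measure_itv/= lte_fin ltr_pMl// ltr1n.
  rewrite youngE ?(ltW s0)// -EFinD -EFinM lee_fin.
  by rewrite (_ : 2 * s - s = s)%R 1?mulrC//; ring.
apply: (@le_trans _ _ +oo); first exact: leey.
apply: (@le_trans _ _ ((slope 1)%:E * leb `]1%R, +oo[%classic)).
  by rewrite lebesgue_measure_itv/= ltry addye// gt0_muley// lte_fin slope_gt0.
apply: (lower `]1%R, +oo[ _ _ (slope_ge0 _)).
- by move=> t /=; rewrite !in_itv/= !andbT; exact: lt_trans.
- move=> t /=; rewrite in_itv/= andbT => t1; rewrite /g ifT.
    by rewrite slope_nd// ltW.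
  have t0 : (0 <= t)%R by rewrite (le_trans _ (ltW t1)).
  apply: (@le_trans _ _ w); last by rewrite ler_peMl// ler1n.
  by rewrite leNgt; apply/negP => /ltW wt; exact/no/(sobolev_h_ivt w0 t0 wt).
Qed.

End young_slope.

(** * Growth of the slope under the nabla_2 condition *)

Section growth.
Context {R : realType}.
Variable A : R -> \bar R.
Hypotheses (youngA : young A) (finA : finite_valued A).

Notation leb := (@lebesgue_measure R).
Notation slope := (slope A).

Lemma measurable_slope_quotient (D : set R) :
  measurable_fun D (fun t => (slope t / t)%:E).
Proof.
apply: measurable_funTS; apply/measurable_EFinP; apply: measurable_funM.
  exact: measurable_slope.
exact: measurable_inv.
Qed.

(** On the dyadic layer [r / 2^(j+1), r / 2^j) the slope has decreased by the
    factor theta^j, and dt/t has mass at most 1. *)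
Lemma slope_dini (r theta : R) : (0 < r)%R -> (0 <= theta < 1)%R ->
  (forall t, (0 < t <= r)%R -> (slope (t / 2) <= theta * slope t)%R) ->
  \int[leb]_(t in `]0%R, r[) (slope t / t)%:E <= (slope r / (1 - theta))%:E.
Proof.
move=> r0 th01 hth; have /andP[th0 th1] := th01.
pose d j := (r / 2 ^+ j)%R.
have d0 j : (0 < d j)%R by rewrite divr_gt0// exprn_gt0.
have dS j : d j.+1 = (d j / 2)%R.
  by rewrite /d exprS; field; rewrite ?expf_neq0 ?pnatr_eq0.
have dr j : (d j <= r)%R.
  by rewrite ler_pdivrMr ?exprn_gt0// ler_peMr ?(ltW r0)// exprn_ege1// ler1n.
have sd j : (slope (d j) <= slope r * theta ^+ j)%R.
  elim: j => [|j ih]; first by rewrite /d expr0 divr1 mulr1.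
  rewrite dS exprS mulrCA; apply: le_trans (hth _ _) _; first by rewrite d0 dr.
  by rewrite ler_wpM2l.
apply: (@integral_le_geometric _ _ _ leb _ _ (fun j => `[d j.+1, d j[%classic)
  (fun j => slope (d j) / d j.+1)%R) => //.
- exact: measurable_slope_quotient.
- move=> t /=; rewrite in_itv/= => /andP[t0 _].
  by rewrite lee_fin divr_ge0 ?slope_ge0// ltW.
- move=> t /=; rewrite in_itv/= => /andP[t0 tr].
  have [|j /andP[j1 j2]] := @dyadic_layer R (r / t)%R.
    by rewrite ltr_pdivlMr// mul1r.
  exists j => //=; rewrite in_itv/= /d; apply/andP; split.
    by rewrite ler_pdivrMr ?exprn_gt0// mulrC -ler_pdivrMr.
  by rewrite ltr_pdivlMr ?exprn_gt0// mulrC -ltr_pdivlMr.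
- by move=> j; rewrite divr_ge0 ?slope_ge0// ltW.
- move=> j t /=; rewrite !in_itv/= => /andP[t0 _] /andP[t1 t2].
  rewrite lee_fin ler_pM ?slope_ge0 ?invr_ge0 ?(ltW t0)//.
    by rewrite slope_nd// ltW.
  by rewrite lef_pV2 ?posrE.
- move=> j /=; rewrite lebesgue_measure_itv/= lte_fin dS ltr_pdivrMr//.
  rewrite ltr_pMr// ltr1n -EFinD -EFinM lee_fin.
  rewrite (_ : slope (d j) / (d j / 2) * (d j - d j / 2) = slope (d j))%R//.
  by field; rewrite gt_eqF.
Qed.

(** The hypothesis on D covers both D = (0, oo), with r = s, and D = (0, t0),
    with r = min(s, t0). *)
Lemma slope_cutoff_integral (D : set R) (theta : R) :
  measurable D -> D `<=` [set t | 0 < t]%R -> (0 <= theta < 1)%R ->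
  (forall s, (0 < s)%R -> exists r, [/\ (0 < r <= s)%R,
     forall t, D t -> (t < s)%R -> (t < r)%R &
     forall t, (0 < t <= r)%R -> (slope (t / 2) <= theta * slope t)%R]) ->
  forall s, (0 <= s)%R ->
  \int[leb]_(t in D) (cutoff t s * (slope t / t))%:E <=
    ((1 - theta)^-1 * (s * slope s))%:E.
Proof.
move=> mD D0 th01 hD s; have /andP[th0 th1] := th01.
rewrite le_eqVlt => /predU1P[<-|s0].
  rewrite integral0_eq ?mul0r ?mulr0//.
  move=> t /D0/= t0; rewrite /cutoff ltNge (ltW t0)/= mul0r//.
have [r [/andP[r0 rs] Dr hr]] := hD _ s0.
apply: (@le_trans _ _ (\int[leb]_(t in `]0%R, r[) (s%:E * (slope t / t)%:E))).
  rewrite integral_mkcond [leRHS]integral_mkcond; apply: le_integralT => t.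
    rewrite patchE; case: ifPn => // /set_mem/D0/= t0.
    by rewrite lee_fin mulr_ge0 ?cutoff_ge0 ?(ltW s0)// divr_ge0 ?slope_ge0// ltW.
  rewrite !patchE; case: ifPn => [/set_mem Dt|_].
    have t0 := D0 _ Dt; rewrite /cutoff; case: ifPn => [ts|_].
      by rewrite ifT ?EFinM// inE/= in_itv/= t0 Dr.
    rewrite mul0r; case: ifP => // _.
    by rewrite -EFinM lee_fin mulr_ge0 ?(ltW s0)// divr_ge0 ?slope_ge0// ltW.
  case: ifPn => // /set_mem/=; rewrite in_itv/= => /andP[t0 _].
  by rewrite -EFinM lee_fin mulr_ge0 ?(ltW s0)// divr_ge0 ?slope_ge0// ltW.
rewrite ge0_integralZl//; last 3 first.
- exact: measurable_slope_quotient.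
- move=> t /=; rewrite in_itv/= => /andP[t0 _].
  by rewrite lee_fin divr_ge0 ?slope_ge0// ltW.
- by rewrite lee_fin ltW.
apply: (@le_trans _ _ (s%:E * (slope r / (1 - theta))%:E)).
  by apply: lee_wpmul2l; [rewrite lee_fin ltW|exact: slope_dini].
rewrite -EFinM lee_fin mulrA mulrC ler_wpM2l ?invr_ge0 ?subr_ge0 ?(ltW th1)//.
by rewrite ler_wpM2l ?(ltW s0)// slope_nd.
Qed.

(** The nabla_2 condition k A(u) <= A(2 u) in terms of slopes; the factor 2 / k
    is below 1 exactly because k > 2. *)
Lemma slope_half (k t : R) : (0 < k)%R -> (0 < t)%R ->
  k%:E * A (t / 2)%R <= A (2 * (t / 2))%R ->
  (slope (t / 2) <= 2 / k * slope t)%R.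
Proof.
move=> k0 t0; have t20 : (0 < t / 2)%R by rewrite divr_gt0.
rewrite (_ : 2 * (t / 2) = t)%R; last by field.
rewrite !(youngE youngA finA) ?(ltW t0) ?(ltW t20)// -EFinM lee_fin => h.
rewrite -(ler_pM2l k0) mulrA (_ : k * (2 / k) = 2)%R; last by field; rewrite gt_eqF.
rewrite -(ler_pM2l t20); move: h; set u := slope (t/2)%R; set v := slope t.
by move=> h; lra.
Qed.

End growth.

(** * The Riesz kernel on R^n *)

Section completed_sigma_finite.
Context d (T : measurableType d) (R : realType)
  (mu : {sigma_finite_measure set T -> \bar R}).

HB.instance Definition _ := Measure_isSigmaFinite.Build _ _ _
  (@completed_measure_extension _ _ R mu)
  (completed_measure_extension_sigma_finite (sigma_finiteT mu)).

End completed_sigma_finite.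

Lemma powR_exprn (R : realType) (a r : R) (j : nat) : (0 <= a)%R ->
  ((a ^+ j) `^ r = (a `^ r) ^+ j)%R.
Proof.
by move=> a0; rewrite -powR_mulrn// -powRrM mulrC powRrM powR_mulrn// powR_ge0.
Qed.

Section euclidean.
Context {R : realType}.

(** The measure lebesgueRn R n, repackaged with its sigma-finiteness so that
    Tonelli's theorem applies to it. *)
Definition complete_lebesgue (n : nat) :
    {sigma_finite_measure set (Rn R n) -> \bar R} :=
  @completed_measure_extension _ _ R (@borel_lebesgue R n).

Lemma measurable_Rn n (B : set (n.-tuple (measurableTypeR R))) :
  measurable B -> measurable (B : set (Rn R n)).
Proof.
move=> mB; apply: (sub_caratheodory (borel_lebesgue n)).
exact: sub_sigma_algebra.
Qed.

Lemma complete_lebesgue_borel n (B : set (n.-tuple (measurableTypeR R))) :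
  measurable B -> complete_lebesgue n B = borel_lebesgue n B.
Proof. exact: measurable_mu_extE. Qed.

Lemma measurable_tnth_Rn n (i : 'I_n) :
  measurable_fun setT (fun x : Rn R n => tnth x i : R).
Proof.
move=> _ Y mY; rewrite setTI; apply: measurable_Rn.
rewrite -[X in measurable X]setTI.
exact: (@measurable_tnth _ (measurableTypeR R) n i).
Qed.

Definition cube n (x : n.-tuple R) (r : R) : set (n.-tuple R) :=
  [set y | forall i, `|tnth x i - tnth y i| < r]%R.

Lemma measurable_cube n (x : n.-tuple R) r :
  measurable (cube x r : set (n.-tuple (measurableTypeR R))).
Proof.
rewrite (_ : cube x r = \bigcap_(i in [set: 'I_n])
    [set y : n.-tuple (measurableTypeR R) | `|tnth x i - tnth y i| < r]%R).
  apply: fin_bigcap_measurable => // i _.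
  have mf : measurable_fun setT
      (fun y : n.-tuple (measurableTypeR R) => `|tnth x i - tnth y i|%R).
    apply: measurableT_comp => //; apply: measurable_funB => //.
    exact: (@measurable_tnth _ (measurableTypeR R) n i).
  rewrite -[X in measurable X]setTI.
  have := @measurable_fun_ltr _ _ R setT _ (cst r) mf (measurable_cst _).
  move/(_ measurableT [set true]); apply => //.
by apply/seteqP; split => [y xy i _|y xy i]; exact: xy.
Qed.

Lemma lebesgue_cube n (x : n.-tuple R) r : (0 <= r)%R ->
  borel_lebesgue n (cube x r) = ((2 * r) ^+ n)%:E.
Proof.
move=> r0; elim: n x => [|n ih] x.
  rewrite /= diracE mem_set// => i; by case: i.
case/tupleP: x => x0 x.
rewrite /= /tuple_product /pushforward.
rewrite (_ : _ @^-1` _ = ball x0 r `*` cube x r); last first.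
  apply/seteqP; split => [[s y] /= xy|[s y] /= [xs xy] i].
    split=> [|i]; first by have := xy ord0; rewrite !tnth0.
    by have := xy (lift ord0 i); rewrite !tnthS.
  by case: (unliftP ord0 i) => [j ->|->]; rewrite ?tnthS ?tnth0//; exact: xy.
rewrite product_measure1E//; last exact: measurable_cube.
  rewrite ih exprS EFinM; congr (_ * _).
  by rewrite mulr_natl; exact: lebesgue_measure_ball.
exact: measurable_ball.
Qed.

Lemma edist_ge0 n (x y : n.-tuple R) : (0 <= Defs.edist x y)%R.
Proof. exact: sqrtr_ge0. Qed.

Lemma edistC n (x y : n.-tuple R) : Defs.edist x y = Defs.edist y x.
Proof.
by rewrite /Defs.edist; congr Num.sqrt; apply: eq_bigr => i _; rewrite -sqrrN opprB.
Qed.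

Lemma coord_le_edist n (x y : n.-tuple R) i :
  (`|tnth x i - tnth y i| <= Defs.edist x y)%R.
Proof.
rewrite -sqrtr_sqr /Defs.edist ler_wsqrtr// (bigD1 i)//= lerDl sumr_ge0// => j _.
exact: sqr_ge0.
Qed.

Lemma measurable_edist n :
  measurable_fun setT (fun z : Rn R n * Rn R n => Defs.edist z.1 z.2).
Proof.
apply: (measurableT_comp (f := (@Num.sqrt R))).
  exact: continuous_measurable_fun (@sqrt_continuous R).
apply: measurable_sum => i; apply: measurable_funX; apply: measurable_funB.
- exact: (measurableT_comp (measurable_tnth_Rn i) measurable_fst).
- exact: (measurableT_comp (measurable_tnth_Rn i) measurable_snd).
Qed.

Variables (n : nat) (alpha : R).
Hypotheses (alpha_gt0 : (0 < alpha)%R) (alpha_ltn : (alpha < n%:R)%R).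

Definition riesz_kernel (x y : Rn R n) : R :=
  ((Defs.edist x y `^ (n%:R - alpha))^-1)%R.

Let rho := (alpha / (n%:R - alpha))%R.

Let na_gt0 : (0 < n%:R - alpha)%R.
Proof. by rewrite subr_gt0. Qed.

Let rho_gt0 : (0 < rho)%R.
Proof. by rewrite divr_gt0. Qed.

Lemma riesz_kernel_ge0 x y : (0 <= riesz_kernel x y)%R.
Proof. by rewrite invr_ge0 powR_ge0. Qed.

Lemma riesz_kernelC x y : riesz_kernel x y = riesz_kernel y x.
Proof. by rewrite /riesz_kernel edistC. Qed.

Lemma measurable_riesz_kernel :
  measurable_fun setT (fun z : Rn R n * Rn R n => riesz_kernel z.1 z.2).
Proof.
apply: (measurableT_comp (@measurable_inv R)).
exact: (measurableT_comp (measurable_powR _) (@measurable_edist n)).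
Qed.

Lemma measurable_riesz_kernelr x : measurable_fun setT (riesz_kernel x).
Proof. exact: (measurableT_comp measurable_riesz_kernel (pair1_measurable x)). Qed.

(** The superlevel set lies in the cube of half-side r = tau^(-1/(n - alpha))
    around x, and (2 r)^n = 2^n tau^(-n/(n - alpha)). *)
Lemma riesz_kernel_level (x : Rn R n) (tau : R) : (0 < tau)%R ->
  complete_lebesgue n [set y | tau < riesz_kernel x y]%R <=
    (2 ^+ n * tau `^ (- (1 + rho)))%:E.
Proof.
move=> tau0.
pose r := (tau `^ (- (n%:R - alpha)^-1))%R.
have r0 : (0 < r)%R by exact: powR_gt0.
have mE : measurable [set y | tau < riesz_kernel x y]%R.
  rewrite -[X in measurable X]setTI.
  have := @measurable_fun_ltr _ _ R setT (cst tau) _ (measurable_cst _)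
    (measurable_riesz_kernelr x).
  by move/(_ measurableT [set true]); apply.
have mc := measurable_cube x r.
apply: (@le_trans _ _ (complete_lebesgue n (cube x r))).
  apply: le_measure; rewrite ?inE//; first exact: measurable_Rn.
  move=> y /= tk i; apply: (le_lt_trans (coord_le_edist _ _ _)).
  have e0 : (0 < Defs.edist x y)%R.
    rewrite lt_neqAle edist_ge0 andbT eq_sym; apply/eqP => e0.
    move: tk; rewrite /riesz_kernel e0 powR0 ?gt_eqF// invr0.
    by rewrite ltNge ltW.
  move: tk; rewrite /riesz_kernel -[X in (X < _)%R]invrK ltf_pV2 ?posrE ?invr_gt0 ?powR_gt0//.
  move=> h; rewrite ltNge; apply/negP => re.
  move: h; rewrite ltNge => /negP; apply.
  apply: (@le_trans _ _ (r `^ (n%:R - alpha))%R); last first.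
    by rewrite ge0_ler_powR ?nnegrE ?(ltW na_gt0) ?edist_ge0 ?(ltW r0).
  by rewrite /r -powRrM mulNr mulVf ?gt_eqF// powR_inv1// ltW.
rewrite complete_lebesgue_borel// lebesgue_cube ?(ltW r0)// exprMn lee_fin.
rewrite ler_wpM2l ?exprn_ge0//.
rewrite -powR_mulrn ?(ltW r0)// /r -powRrM.
rewrite (_ : - (n%:R - alpha)^-1 * n%:R = - (1 + rho))%R//.
by rewrite /rho; field; rewrite gt_eqF.
Qed.

Definition kernel_constant : R := (2 ^+ n.+1 / (1 - 2 `^ (- rho)))%R.

Lemma powR2N_lt1 : ((0 : R) <= 2 `^ (- rho) < 1)%R.
Proof.
rewrite powR_ge0/= powRN invf_lt1 ?powR_gt0//.
have := @gt0_ltr_powR R rho rho_gt0 1%R 2%R.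
by rewrite !nnegrE powR1; apply => //; rewrite ltr1n.
Qed.

Lemma kernel_constant_ge0 : (0 <= kernel_constant)%R.
Proof.
have /andP[_ h] := powR2N_lt1.
by rewrite divr_ge0 ?exprn_ge0// subr_ge0 ltW.
Qed.

(** Summation over the layers 2^j tau < k <= 2^(j+1) tau: each contributes at
    most 2^(j+1) tau times the measure of the superlevel set at 2^j tau, a
    geometric sequence of ratio 2^(-rho). *)
Lemma riesz_kernel_cutoff (x : Rn R n) (tau : R) : (0 < tau)%R ->
  \int[complete_lebesgue n]_y (cutoff tau (riesz_kernel x y))%:E <=
    (kernel_constant * tau `^ (- rho))%:E.
Proof.
move=> tau0; pose D := [set y | tau < riesz_kernel x y]%R.
have mlt (s : R) : measurable [set y | s < riesz_kernel x y]%R.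
  rewrite -[X in measurable X]setTI.
  have := @measurable_fun_ltr _ _ R setT (cst s) _ (measurable_cst _)
    (measurable_riesz_kernelr x).
  by move/(_ measurableT [set true]); apply.
have mle (s : R) : measurable [set y | riesz_kernel x y <= s]%R.
  rewrite -[X in measurable X]setTI.
  have := @measurable_fun_ler _ _ R setT _ (cst s)
    (measurable_riesz_kernelr x) (measurable_cst _).
  by move/(_ measurableT [set true]); apply.
have -> : \int[complete_lebesgue n]_y (cutoff tau (riesz_kernel x y))%:E =
    \int[complete_lebesgue n]_(y in D) (riesz_kernel x y)%:E.
  rewrite [RHS]integral_mkcond; apply: eq_integral => y _.
  rewrite patchE /cutoff; case: ifPn => [h|h]; first by rewrite mem_set.
  by rewrite memNset//; exact/negP.
rewrite /kernel_constant mulrAC.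
pose E j := [set y | 2 ^+ j * tau < riesz_kernel x y]%R `&`
  [set y | riesz_kernel x y <= 2 ^+ j.+1 * tau]%R.
have mE j : measurable (E j) by exact: measurableI.
apply: (@integral_le_geometric _ _ _ (complete_lebesgue n) _ _ E
  (fun j => 2 ^+ j.+1 * tau)%R).
- exact: mlt.
- apply: measurable_funTS; apply/measurable_EFinP; exact: measurable_riesz_kernelr.
- by move=> y _; rewrite lee_fin riesz_kernel_ge0.
- exact: mE.
- move=> y /= ty.
  have [|j /andP[j1 j2]] := @dyadic_layer R (riesz_kernel x y / tau)%R.
    by rewrite ltr_pdivlMr// mul1r.
  by exists j => //; split => /=; rewrite -?ltr_pdivlMr// -?ler_pdivrMr.
- by move=> j; rewrite mulr_ge0 ?exprn_ge0// ltW.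
- by move=> j y _ [_ /=]; rewrite lee_fin.
- exact: powR2N_lt1.
move=> j.
have p0 : (0 < 2 ^+ j * tau)%R by rewrite mulr_gt0 ?exprn_gt0.
apply: (@le_trans _ _ ((2 ^+ j.+1 * tau)%:E *
    (2 ^+ n * (2 ^+ j * tau) `^ (- (1 + rho)))%:E)).
  apply: lee_wpmul2l; first by rewrite lee_fin mulr_ge0 ?exprn_ge0// ltW.
  apply: le_trans (riesz_kernel_level x p0).
  by apply: le_measure; rewrite ?inE//; exact: subIsetl.
rewrite -EFinM lee_fin opprD powRD ?(gt_eqF p0) ?implybT// powR_inv1 ?(ltW p0)//.
rewrite powRM ?exprn_ge0 ?(ltW tau0)//.
rewrite powR_exprn//.
rewrite !exprS.
rewrite le_eqVlt; apply/orP; left; apply/eqP.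
have : (2 ^+ j != 0 :> R)%R by rewrite expf_neq0.
move=> u0; field.
by rewrite u0 gt_eqF.
Qed.

End euclidean.

(** * Modular estimates for the Riesz potential *)

Section riesz_estimates.
Context {R : realType}.
Variables (n : nat) (alpha : R).
Hypotheses (alpha_gt0 : (0 < alpha)%R) (alpha_ltn : (alpha < n%:R)%R).
Variable A : R -> \bar R.
Hypotheses (youngA : young A) (finA : finite_valued A).
Hypothesis conv0 : sobolev_conv0 n alpha A.

Notation leb := (@lebesgue_measure R).
Notation mu := (complete_lebesgue n : {sigma_finite_measure set (Rn R n) -> \bar R}).
Notation slope := (slope A).
Notation h := (sobolev_h A n alpha).
Notation c0 := (@kernel_constant R n alpha).
Notation pot := (potential mu (@riesz_kernel R n alpha)).

Let rho := (alpha / (n%:R - alpha))%R.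

Let rho_gt0 : (0 < rho)%R.
Proof. by rewrite divr_gt0// subr_gt0. Qed.

Let c0_ge0 : (0 <= c0)%R.
Proof. exact: kernel_constant_ge0. Qed.

Let kr (x : Rn R n) (tau : R) : (0 < tau)%R ->
  \int[mu]_y (cutoff tau (riesz_kernel alpha x y))%:E <= (c0 * tau `^ (- rho))%:E.
Proof. exact: riesz_kernel_cutoff. Qed.

Let kl (y : Rn R n) (tau : R) : (0 < tau)%R ->
  \int[mu]_x (cutoff tau (riesz_kernel alpha x y))%:E <= (c0 * tau `^ (- rho))%:E.
Proof.
move=> tau0; under eq_integral do rewrite riesz_kernelC.
exact: riesz_kernel_cutoff.
Qed.

Let hE t : \int[leb]_(s in `]0%R, t[) (slope s `^ (- rho))%:E <=
  (h t `^ (1 + rho))%:E.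
Proof.
by have := sobolev_hX youngA finA alpha_gt0 alpha_ltn conv0 t => <-.
Qed.

Definition unit_modular (f : Rn R n -> R) :=
  [/\ measurable_fun setT f, (forall y, 0 <= f y)%R &
    \int[mu]_y (f y * slope (f y))%:E <= 1].

Let phi_nd := slope_nd youngA finA.
Let phi_ge0 := slope_ge0 youngA.
Let phi_gt0 := slope_gt0 youngA finA alpha_gt0 alpha_ltn conv0.

Lemma riesz_weak_type (f : Rn R n -> R) (t : R) : (0 < t)%R -> unit_modular f ->
  mu [set x | ((2 + c0) * h t)%:E <= pot f x] <=
    (c0 * 2 `^ (1 + rho) / t)%:E * \int[mu]_y (cutoff t (f y))%:E.
Proof.
move=> t0 [mf f0 f1].
apply: (@potential_weak_type _ _ _ mu _ rho c0 (@riesz_kernel_ge0 _ _ _)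
  (@measurable_riesz_kernel _ _ _) rho_gt0 c0_ge0 kr kl slope phi_nd phi_gt0 phi_ge0) => //.
exact: sobolev_h_gt0.
Qed.

Lemma riesz_bounded (f : Rn R n -> R) (N : R) : (0 < N)%R -> unit_modular f ->
  \int[leb]_(s in `]0%R, +oo[) (slope s `^ (- rho))%:E <= (N `^ (1 + rho))%:E ->
  forall x, pot f x <= ((1 + c0) * N)%:E.
Proof.
move=> N0 [mf f0 f1] hN.
apply: (@potential_bounded _ _ _ mu _ rho c0 (@riesz_kernel_ge0 _ _ _)
  (@measurable_riesz_kernel _ _ _) c0_ge0 kr slope phi_nd phi_gt0 phi_ge0 N
  `]0%R, +oo[) => //.
- by move=> s /=; rewrite in_itv/= andbT.
- by move=> y s /=; rewrite !in_itv/= andbT => /andP[].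
Qed.

(** The weak-type bound at level t is at most a multiple of 1/(t phi(t)), which
    tends to 0 as t grows. *)
Lemma potential_ae_finite (f : Rn R n -> R) : unit_modular f ->
  mu [set x | pot f x = +oo] = 0.
Proof.
move=> uf; have [mf f0 f1] := uf.
have mpot := measurable_potential mu (@riesz_kernel_ge0 _ _ alpha)
  (@measurable_riesz_kernel _ _ _) mf f0.
have mE y : measurable [set x | y <= pot f x].
  by rewrite -[X in measurable X]setTI; exact: emeasurable_fun_c_infty.
have mI : measurable [set x | pot f x = +oo].
  rewrite (_ : [set x | _] = [set x | +oo <= pot f x])//.
  by apply/seteqP; split => x /=; rewrite leye_eq => /eqP.
apply/eqP; rewrite eq_le measure_ge0 andbT; apply/lee_addgt0Pr => e e0.
rewrite add0e.
pose K := (c0 * 2 `^ (1 + rho))%R.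
have K0 : (0 <= K)%R by rewrite mulr_ge0// powR_ge0.
have s1 : (0 < slope 1)%R by exact: phi_gt0.
pose t := Num.max 1%R (K / (slope 1 * e))%R.
have t1 : (1 <= t)%R by rewrite le_max lexx.
have t0 : (0 < t)%R by exact: lt_le_trans t1.
apply: (@le_trans _ _ (mu [set x | ((2 + c0) * h t)%:E <= pot f x])).
  by apply: le_measure; rewrite ?inE// => x /= ->; exact: leey.
apply: (le_trans (riesz_weak_type t0 uf)).
apply: (@le_trans _ _ ((K / t)%:E * ((slope t)^-1)%:E)).
  apply: lee_wpmul2l; first by rewrite lee_fin divr_ge0// ltW.
  exact: part_above_integral.
rewrite -EFinM lee_fin.
have st : (slope 1 <= slope t)%R by exact: phi_nd.
have st0 : (0 < slope t)%R by exact: phi_gt0.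
rewrite ler_pdivrMr// ler_pdivrMr//.
have : (K / (slope 1 * e) <= t)%R by rewrite le_max lexx orbT.
rewrite ler_pdivrMr ?mulr_gt0// => /le_trans; apply.
rewrite (_ : t * (slope 1 * e) = e * t * slope 1)%R; last by ring.
rewrite (_ : e * slope t * t = e * t * slope t)%R; last by ring.
by rewrite ler_wpM2l// mulr_ge0// ltW.
Qed.

Hypothesis nablaA : nabla2 A \/ (nabla2_near0 A /\ sobolev_convy n alpha A).

Lemma conj_integral_total : sobolev_convy n alpha A ->
  exists2 N, (0 < N)%R &
    \int[leb]_(s in `]0%R, +oo[) (slope s `^ (- rho))%:E <= (N `^ (1 + rho))%:E.
Proof.
move=> [b b0 boo].
have Ib : \int[leb]_(s in `]b, +oo[) (slope s `^ (- rho))%:E < +oo.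
  rewrite (@eq_integral _ _ _ leb _ (sobolev_integrand n alpha A))//.
  move=> s; rewrite inE/= in_itv/= andbT => bs.
  by rewrite sobolev_integrandE// (lt_trans b0).
have mphir D := measurable_slopeN youngA finA n alpha (D := D).
have p0 s : 0 <= (slope s `^ (- rho))%:E by rewrite lee_fin powR_ge0.
set I := \int[leb]_(s in _) _.
have I0 : 0 <= I by apply: integral_ge0.
have Ioo : I < +oo.
  rewrite /I (_ : `]0%R, +oo[%classic = `]0%R, b] `|` `]b, +oo[); last first.
    by rewrite -itv_bndbnd_setU// bnd_simp// ltW.
  rewrite ge0_integral_setU//; last first.
  - apply/disj_setPS => s [/=]; rewrite !in_itv/= andbT => /andP[_ sb] bs.
    by move: (lt_le_trans bs sb); rewrite ltxx.
  - exact: mphir.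
  rewrite lte_add_pinfty// (@integral_itv_bndoo _ _ _ _ false false); last exact: mphir.
  exact: (conj_integral_lty youngA finA alpha_gt0 alpha_ltn conv0 b).
exists ((fine I + 1) `^ ((1 + rho)^-1))%R.
  by rewrite powR_gt0// ltr_wpDl// fine_ge0.
rewrite -powRrM mulVf ?gt_eqF ?addr_gt0// powRr1 ?addr_ge0 ?fine_ge0//.
rewrite EFinD fineK ?leeDl// ge0_fin_numE//.
Qed.

(** Under the global condition every level is admissible.  Otherwise, let the
    condition hold on (0, t0): then D = (0, t0), and kappa is chosen so large
    that kappa H(t0) exceeds the sup bound of riesz_bounded. *)
Lemma admissible_levels : exists (D : set R) (CJ kappa : R),
  [/\ measurable D, D `<=` [set t | 0 < t]%R, (0 <= CJ)%R,
    (forall s, (0 <= s)%R -> \int[leb]_(t in D) (cutoff t s * (slope t / t))%:E <=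
     (CJ * (s * slope s))%:E) & (2 + c0 <= kappa)%R] /\
  forall f, unit_modular f -> forall x t, (0 < t)%R ->
    (kappa * h t)%:E <= pot f x -> D t.
Proof.
have th01 k : (2 < k)%R -> ((0 : R) <= 2 / k < 1)%R.
  by move=> k2; have k0 : (0 < k)%R by [exact: lt_trans k2];
    rewrite divr_ge0 ?(ltW k0)//= ltr_pdivrMr// mul1r.
case: nablaA => [[k k2 hk]|[[k k2 [t0 t00 hk]] cy]]; have k0 : (0 < k)%R by exact: lt_trans k2.
  exists `]0%R, +oo[%classic, ((1 - 2 / k)^-1)%R, (2 + c0)%R; split; last first.
    by move=> f _ x t tpos _; rewrite /= in_itv/= tpos.
  have D0 : `]0%R, +oo[ `<=` [set t : R | (0 < t)%R].
    by move=> s /=; rewrite in_itv/= andbT.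
  split => //.
    by rewrite invr_ge0 subr_ge0 ltW//; have /andP[] := th01 _ k2.
  apply: (slope_cutoff_integral youngA finA _ D0 (th01 _ k2)) => // s s0.
  exists s; split => //; first by rewrite s0 lexx.
  move=> t /andP[tpos _]; apply: (slope_half youngA finA k0 tpos).
  by apply: hk; rewrite divr_ge0// ltW.
have [N N0 hN] := conj_integral_total cy.
have h0 : (0 < h t0)%R by exact: sobolev_h_gt0.
exists `]0%R, t0[%classic, ((1 - 2 / k)^-1)%R,
  (2 + c0 + (1 + c0) * N / h t0)%R; split; last first.
  move=> f uf x t tpos le1; rewrite /= in_itv/= tpos ltNge; apply/negP => tt.
  have := le_trans le1 (riesz_bounded N0 uf hN x).
  rewrite lee_fin; apply/negP; rewrite -ltNge.
  apply: (@lt_le_trans _ _ ((2 + c0 + (1 + c0) * N / h t0) * h t0)%R); last first.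
    rewrite ler_wpM2l ?sobolev_h_nd//.
    by rewrite !addr_ge0// divr_ge0 ?mulr_ge0 ?addr_ge0// ltW.
  rewrite [ltRHS]mulrDl divfK ?gt_eqF// ltrDr mulr_gt0// ltr_pwDl//.
have D0 : `]0%R, t0[ `<=` [set t : R | (0 < t)%R].
  by move=> s /=; rewrite in_itv/= => /andP[].
split => //.
- by rewrite invr_ge0 subr_ge0 ltW//; have /andP[] := th01 _ k2.
- apply: (slope_cutoff_integral youngA finA _ D0 (th01 _ k2)) => // s s0.
  exists (Num.min s t0); split.
  + by rewrite lt_min s0 t00/= ge_min lexx.
  + by move=> t /=; rewrite in_itv/= => /andP[_ tt] ts; rewrite lt_min ts.
  + move=> t /andP[tpos]; rewrite le_min => /andP[_ tt].
    apply: (slope_half youngA finA k0 tpos).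
    apply: hk; rewrite divr_ge0 ?(ltW tpos)//= ltr_pdivrMr//.
    by rewrite (le_lt_trans tt)// ltr_pMr// ltr1n.
- by rewrite lerDl divr_ge0 ?mulr_ge0 ?addr_ge0// ltW.
Qed.

(** Combines the bound of the conjugate by an integral over levels with
    potential_modular; kappa absorbs the constants of the weak-type bound. *)
Lemma riesz_conjugate_modular : exists C1 kappa : R, [/\ (0 <= C1)%R, (0 < kappa)%R &
  forall f, unit_modular f -> forall w : Rn R n -> R, (forall x, 0 <= w x)%R ->
    (forall x, (kappa * (2 * w x))%:E <= pot f x) ->
    \int[mu]_x sobolev_conjugate n alpha A (w x) <=
      C1%:E * \int[mu]_y (f y * slope (f y))%:E].
Proof.
have [D [CJ [kappa [[mD D0 CJ0 hJ kc] hD]]]] := admissible_levels.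
have kappa0 : (0 < kappa)%R by apply: lt_le_trans kc; rewrite ltr_pwDl.
exists (c0 * 2 `^ (1 + rho) * CJ)%R, kappa; split => //.
  by apply: mulr_ge0 => //; apply: mulr_ge0 => //; exact: powR_ge0.
move=> f uf w w0 wf; have [mf f0 f1] := uf.
apply: le_trans (@potential_modular _ _ _ mu _ rho c0 (@riesz_kernel_ge0 _ _ _)
  (@measurable_riesz_kernel _ _ _) rho_gt0 c0_ge0 kr kl slope phi_nd phi_gt0
  phi_ge0 h D kappa CJ f _ _ _ mD D0 CJ0 hJ kc mf f0 f1 (hD _ uf)).
- apply: le_integralT => x; first exact: sobolev_conjugate_ge0.
  apply: (le_trans (sobolev_conjugate_le youngA finA alpha_gt0 alpha_ltn conv0 (w0 x))).
  have mif (b : R -> bool) : measurable_fun setT b ->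
      measurable_fun (`]0%R, +oo[%classic : set R) (fun t : R => (if b t then slope t else 0%R)%:E).
    move=> mb; apply: measurable_funTS; apply/measurable_EFinP.
    by apply: measurable_fun_ifT => //; exact: measurable_slope.
  have mh : measurable_fun setT h by exact: measurable_sobolev_h.
  apply: ge0_le_integral => //.
  - by move=> t _; rewrite lee_fin; case: ifP.
  - by apply: mif; exact: measurable_fun_ler.
  - apply: mif; apply: measurable_fun_lee => //.
    by apply/measurable_EFinP; exact: measurable_funM.
  - move=> t _; rewrite lee_fin; case: ifPn => [hw|_]; last by case: ifP.
    rewrite ifT//; apply: le_trans (wf x); rewrite lee_fin.
    by rewrite ler_wpM2l// ltW.
- exact: measurable_sobolev_h.
- by move=> t t0; exact: sobolev_h_gt0.
- by move=> t t0; exact: hE.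
Qed.

End riesz_estimates.

(** * From modulars to norms *)

Lemma measurable_riesz_potential (R : realType) (n : nat) (alpha : R)
    (f : Rn R n -> R) : measurable_fun setT f ->
  measurable_fun setT (riesz_potential alpha f).
Proof.
move=> mf.
pose F (z : Rn R n * Rn R n) := (f z.2 * riesz_kernel alpha z.1 z.2)%:E.
have mF : measurable_fun setT F.
  apply/measurable_EFinP; apply: measurable_funM.
    exact: (measurableT_comp mf measurable_snd).
  exact: measurable_riesz_kernel.
have mFp := measurable_funepos mF.
have mFn := measurable_funeneg mF.
have mpos := @measurable_fun_fubini_tonelli_F _ _ _ _ _ (complete_lebesgue n)
  _ mFp (fun z => funepos_ge0 F z).
have mneg := @measurable_fun_fubini_tonelli_F _ _ _ _ _ (complete_lebesgue n)
  _ mFn (fun z => funeneg_ge0 F z).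
have mI : measurable_fun setT (fun x => \int[complete_lebesgue n]_y F (x, y)).
  have := emeasurable_funB mpos mneg.
  congr (measurable_fun _ _); apply/funext => x.
  rewrite [RHS]integralE; congr (_ - _);
    by apply: eq_integral => y _; rewrite ?funeposE ?funenegE.
have mf' : measurable_fun setT (fun x => fine (\int[complete_lebesgue n]_y F (x, y))).
  exact: (measurableT_comp (fine_measurable measurableT) mI).
exact: (measurable_funM (measurable_cst _) mf').
Qed.

Lemma measurable_norm_div d (X : measurableType d) (R : realType) (f : X -> R)
    (a : R) : measurable_fun setT f -> measurable_fun setT (fun y => `|f y| / a)%R.
Proof. by move=> mf; apply: measurable_funM => //; exact: measurableT_comp. Qed.

(** By convexity, dividing the argument of A by M >= 1 divides its value by at
    least M. *)
Lemma modular_scale d (X : measurableType d) (R : realType)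
    (mu : {measure set X -> \bar R}) (A : R -> \bar R) (f : X -> R) (l M : R) :
  young A -> finite_valued A -> measurable_fun setT f -> (0 < l)%R -> (1 <= M)%R ->
  \int[mu]_x A (`|f x| / l)%R <= 1 ->
  \int[mu]_y (`|f y| / (l * M) * slope A (`|f y| / (l * M)))%:E <= (M^-1)%:E.
Proof.
move=> youngA finA mf l0 M1 fl.
have M0 : (0 < M)%R by exact: lt_le_trans M1.
have lM0 : (0 < l * M)%R by rewrite mulr_gt0.
have msl (u : X -> R) : measurable_fun setT u ->
    measurable_fun setT (fun y => (u y * slope A (u y))%:E).
  move=> mu'; apply/measurable_EFinP; apply: measurable_funM => //.
  exact: (measurableT_comp (measurable_slope youngA finA) mu').
apply: (@le_trans _ _ ((M^-1)%:E * \int[mu]_x A (`|f x| / l)%R)); last first.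
  rewrite -[leRHS]mule1; apply: lee_wpmul2l => //.
  by rewrite lee_fin invr_ge0 ltW.
have AE x : A (`|f x| / l)%R = (`|f x| / l * slope A (`|f x| / l))%:E.
  by rewrite {1}(youngE youngA finA)// divr_ge0// ltW.
under [in leRHS]eq_integral do rewrite AE.
have p0 (a : R) x : (0 < a)%R -> 0 <= (`|f x| / a * slope A (`|f x| / a))%:E.
  by move=> a0; rewrite lee_fin mulr_ge0 ?slope_ge0// divr_ge0// ltW.
rewrite -ge0_integralZl//; last 3 first.
- exact/msl/measurable_norm_div.
- by move=> x _; exact: p0.
- by rewrite lee_fin invr_ge0 ltW.
apply: ge0_le_integral => //.
- by move=> x _; exact: p0.
- exact/msl/measurable_norm_div.
- by apply: measurable_funeM; exact/msl/measurable_norm_div.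
move=> x _; rewrite -EFinM lee_fin mulrA [(M^-1 * _)%R]mulrC -[X in (_ <= X * _)%R]mulrA -invfM.
apply: ler_wpM2l; first by rewrite divr_ge0// ltW.
apply: slope_nd => //; rewrite ler_wpM2l// lef_pV2 ?posrE//.
by rewrite ler_peMr// ltW.
Qed.

Lemma potential_scale d (X : measurableType d) (R : realType)
    (mu : {sigma_finite_measure set X -> \bar R}) (k : X -> X -> R) (f : X -> R)
    (a : R) (x : X) :
  (forall y, 0 <= k x y)%R -> measurable_fun setT (k x) ->
  measurable_fun setT f -> (0 < a)%R ->
  \int[mu]_y (`|f y| * k x y)%:E =
    a%:E * potential mu k (fun y => `|f y| / a)%R x.
Proof.
move=> k0 mk mf a0; rewrite /potential -ge0_integralZl//.
- apply: eq_integral => y _; rewrite -EFinM; congr EFin.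
  by field; rewrite gt_eqF.
- apply/measurable_EFinP; apply: measurable_funM => //.
  exact: measurable_norm_div.
- by move=> y _; rewrite lee_fin mulr_ge0// divr_ge0// ltW.
- by rewrite lee_fin ltW.
Qed.

Unset Implicit Arguments.
Set Strict Implicit.
Set Printing Implicit Defensive.

Theorem lemma5p3 (R : realType) (n : nat) (n_ge2 : (2 <= n)%N)
    (alpha : R) (alpha_gt0 : (0 < alpha)%R) (alpha_ltn : (alpha < n%:R)%R)
    (A : R -> \bar R) (youngA : young A) (finA : finite_valued A)
    (conv0 : sobolev_conv0 n alpha A)
    (nablaA : nabla2 A \/ (nabla2_near0 A /\ sobolev_convy n alpha A)) :
  exists C : R, forall f : Rn R n -> R, orlicz A f ->
    [/\ {ae lebesgueRn R n, forall x, (lebesgueRn R n).-integrable setT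
           (fun y => (riesz_integrand alpha f x y)%:E)},
        orlicz (sobolev_conjugate n alpha A) (riesz_potential alpha f) &
        luxemburg_norm (sobolev_conjugate n alpha A) (riesz_potential alpha f)
          <= C%:E * luxemburg_norm A f].
Proof.
have [C1 [kappa [C10 kappa0 conj]]] :=
  riesz_conjugate_modular alpha_gt0 alpha_ltn youngA finA conv0 nablaA.
pose M := (C1 + 1)%R.
have M1 : (1 <= M)%R by rewrite lerDr.
have M0 : (0 < M)%R by exact: lt_le_trans M1.
pose gam := (Gamma ((n%:R - alpha) / 2) /
     (2 `^ alpha * pi `^ (n%:R / 2) * Gamma (alpha / 2)))%R.
pose C := (2 * kappa * (`|gam| + 1) * M)%R.
have gam0 : (0 < `|gam| + 1)%R by rewrite ltr_wpDl.
have C0 : (0 < C)%R by rewrite !mulr_gt0.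
pose mu := complete_lebesgue n : {sigma_finite_measure set (Rn R n) -> \bar R}.
exists C => f [mf normf].
(* For l admissible in the norm of f, the extra factor M makes the modular of
   g l at most 1/M, so that C1 times it is at most 1. *)
pose g l y := (`|f y| / (l * M))%R.
have key l : (0 < l)%R -> \int[mu]_x A (`|f x| / l)%R <= 1 ->
    unit_modular A (g l) /\
    \int[mu]_y (g l y * slope A (g l y))%:E <= (M^-1)%:E.
  move=> l0 fl.
  have lM0 : (0 < l * M)%R by rewrite mulr_gt0.
  have mod := modular_scale youngA finA mf l0 M1 fl.
  split; last exact: mod.
  split.
  - exact: measurable_norm_div.
  - by move=> y; rewrite divr_ge0// ltW.
  - by apply: (le_trans mod); rewrite lee_fin invf_le1.
have potE l x : (0 < l)%R ->
    \int[mu]_y (`|f y| * riesz_kernel alpha x y)%:E =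
    (l * M)%:E * potential mu (@riesz_kernel R n alpha) (g l) x.
  move=> l0; have lM0 : (0 < l * M)%R by rewrite mulr_gt0.
  exact: (potential_scale _ (riesz_kernel_ge0 _ _)
    (measurable_riesz_kernelr alpha x) mf lM0).
have mint x : measurable_fun setT (fun y => (riesz_integrand alpha f x y)%:E).
  apply/measurable_EFinP.
  exact: (measurable_funM mf (measurable_riesz_kernelr alpha x)).
have absE x : \int[mu]_y `|(riesz_integrand alpha f x y)%:E| =
    \int[mu]_y (`|f y| * riesz_kernel alpha x y)%:E.
  apply: eq_integral => y _; rewrite /= normrM.
  by rewrite (ger0_norm (riesz_kernel_ge0 _ _ _)).
have bound l : (0 < l)%R -> \int[mu]_x A (`|f x| / l)%R <= 1 ->
    \int[mu]_x sobolev_conjugate n alpha A (`|riesz_potential alpha f x| / (C * l))%R <= 1.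
  move=> l0 fl; have [ug modg] := key l l0 fl.
  have Cl0 : (0 < C * l)%R by rewrite mulr_gt0.
  have lM0 : (0 < l * M)%R by rewrite mulr_gt0.
  apply: le_trans (conj _ ug _ _ _) _.
  - by move=> x; rewrite divr_ge0// ltW.
  - move=> x.
    have pot0 : 0 <= potential mu (@riesz_kernel R n alpha) (g l) x.
      apply: integral_ge0 => y _.
      by rewrite lee_fin mulr_ge0 ?riesz_kernel_ge0// divr_ge0// ltW.
    have := le_abse_integral mu measurableT (mint x).
    rewrite absE (potE l)// /riesz_potential -/gam normrM.
    rewrite [(\int[_]_y riesz_integrand _ _ _ _)%R]/Rintegral.
    change (lebesgueRn R n) with (mu : {measure set (Rn R n) -> \bar R}).
    move: pot0; rewrite -/mu; case: (potential _ _ _ _) => [p| |] //; last first.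
      by move=> _ _; exact: leey.
    rewrite lee_fin => p0; case: (integral _ _ _) => [z| |] //=.
    rewrite -EFinM !lee_fin => zp.
    apply: (@le_trans _ _ (kappa * (2 * (`|gam| * (l * M * p) / (C * l))))%R).
      rewrite !ler_wpM2l ?(ltW kappa0)//.
      by rewrite ler_wpM2r ?invr_ge0 ?(ltW Cl0)// ler_wpM2l.
    rewrite (_ : kappa * _ = `|gam| / (`|gam| + 1) * p)%R; last first.
      by rewrite /C; field; rewrite !gt_eqF.
    by rewrite ler_piMl// ler_pdivrMr// mul1r lerDl.
  - apply: (@le_trans _ _ (C1%:E * (M^-1)%:E)).
      by apply: lee_wpmul2l => //; rewrite lee_fin.
    by rewrite -EFinM lee_fin ler_pdivrMr// mul1r lerDl.
have [l0 [l00 fl0]] : exists l, (0 < l)%R /\ \int[mu]_x A (`|f x| / l)%R <= 1.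
  have [_ [l [l0 fl] <-] _] := ereal_inf_lt normf.
  by exists l.
have normle l : (0 < l)%R -> \int[mu]_x A (`|f x| / l)%R <= 1 ->
    luxemburg_norm (sobolev_conjugate n alpha A) (riesz_potential alpha f) <=
      (C * l)%:E.
  move=> l_gt0 fl; apply: ereal_inf_lbound; exists (C * l)%R => //; split.
    by rewrite mulr_gt0.
  exact: bound.
split.
- have [ug _] := key l0 l00 fl0.
  exists [set x | potential mu (@riesz_kernel R n alpha) (g l0) x = +oo]; split.
  + have [mg g0 _] := ug.
    have mpot := measurable_potential mu (@riesz_kernel_ge0 _ _ alpha)
      (@measurable_riesz_kernel _ _ _) mg g0.
    by rewrite -[X in measurable X]setTI; exact: (mpot measurableT [set +oo]).
  + exact: potential_ae_finite ug.
  + move=> x /= nint; apply: contrapT => fin; apply: nint.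
    apply/integrableP; split; first exact: mint.
    rewrite absE (potE l0)// lte_mul_pinfty//.
      by rewrite lee_fin mulr_ge0// ltW.
    by rewrite ltey; apply/eqP.
- split; first exact: measurable_riesz_potential.
  exact: le_lt_trans (normle _ l00 fl0) (ltry _).
- rewrite -ereal_inf_pZl//; apply: le_ereal_inf_tmp => _ [_ [l [l_gt0 fl] <-] <-].
  by rewrite -EFinM; exact: normle.
Qed.
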